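(* Let $\gamma\in(0,1)$ or $\gamma\in(-1,0)$, and let $\beta$ be the real number with $\beta^2+\gamma^2=1$ and having the same sign as $\gamma$. The conjugate surface of the generalized catenoid $\mathcal{G}_\gamma$ in $\mathbb{H}^2\times\mathbb{R}$ is the helicoid $\mathcal{H}_\beta$ in $\mathbb{H}^2\times\mathbb{R}$.
   Context: $\mathbb{H}^2=\{(x^0,x^1,x^2): -(x^0)^2+(x^1)^2+(x^2)^2=-1,\ x^0>0\}$ in Lorentz space $\mathbb{L}^3$ with form $-(dx^0)^2+(dx^1)^2+(dx^2)^2$, and $\mathbb{H}^2\times\mathbb{R}\subset\mathbb{L}^3\times\mathbb{R}$. Helicoid $\mathcal{H}_\beta$ ($\beta\ne0$): the surface given by the conformal minimal immersion $$x(u,v)=(\cosh\varphi(u),\ \sinh\varphi(u)\cos\beta v,\ \sinh\varphi(u)\sin\beta v,\ v),$$ where $\varphi'^2=1+\beta^2\sinh^2\varphi$, $\varphi''=\beta^2\sinh\varphi\cosh\varphi$, $\varphi(0)=0$, $\varphi'>0$ (maximal solution, defined on a bounded interval), $v\in\mathbb{R}$, with unit normal $N=\frac{1}{\varphi'(u)}(0,\sin\beta v,-\cos\beta v,\beta\sinh\varphi(u))$. Generalized catenoid $\mathcal{G}_\gamma$: the surface given by the conformal minimal immersion $$x(u,v)=(\cosh\chi(u)\cosh\gamma v,\ \sinh\chi(u),\ \cosh\chi(u)\sinh\gamma v,\ u),$$ where $1+\chi'^2=\gamma^2\cosh^2\chi$, $\chi''=\gamma^2\cosh\chi\sinh\chi$,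 $\chi'(0)=0$, $\chi>0$ (maximal solution, defined on $(-u_0,u_0)$ with $u_0=\int_1^\infty\frac{dx}{\sqrt{(x^2-\gamma^2)(x^2-1)}}$), $v\in\mathbb{R}$, with unit normal $N=-\frac{1}{\gamma\cosh\chi(u)}(\sinh\chi(u)\cosh\gamma v,\cosh\chi(u),\sinh\chi(u)\sinh\gamma v,-\chi'(u))$. In both cases $z=u+iv$ is the conformal coordinate. Conjugation: for a conformal minimal immersion $x:\Sigma\to\mathbb{M}^2\times\mathbb{R}$ ($\mathbb{M}^2=\mathbb{S}^2$ or $\mathbb{H}^2$) of a simply connected Riemann surface with unit normal $N$, let $ds^2$ be the induced metric, $S$ the symmetric operator on $\Sigma$ with $dx(SX)=-\bar\nabla_XN$ ($\bar\nabla$ the connection of $\mathbb{M}^2\times\mathbb{R}$), $T$ the vector field on $\Sigma$ with $dx(T)$ equal to the tangential projection of $\frac{\partial}{\partial t}$ (the unit vector field of the factor $\mathbb{R}$), and $\nu=\langle N,\frac{\partial}{\partial t}\rangle$. Let $J$ be the rotation by $\frac\pi2$ on $T\Sigma$. The conjugate immersion of $x$ is the conformal minimal immersion of $\Sigma$ whose corresponding data are $(ds^2,JS,JT,\nu)$; it is well defined up to isometries of $\mathbb{M}^2\times\mathbb{R}$ preserving the orientations of both $\mathbb{M}^2$ and $\mathbb{R}$, and conjugate surfaces are considered up to such isometries. The surface it parametrizes is the conjugate surface. The unit normals are the ones for which $(dx(e_1),dx(e_2),N)$ is direct for direct frames $(e_1,e_2)$ of $\Sigma$ (the normals given above are of this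 kind). *)

(* Defs.v *)
From Stdlib Require Import Reals.
From Coquelicot Require Import Coquelicot.
Open Scope R_scope.

(** ** Lorentz space L^3, the hyperbolic plane, and H^2 x R *)

Record L3 := mkL3 { x0 : R; x1 : R; x2 : R }.

Definition L3_add (p q : L3) : L3 := mkL3 (x0 p + x0 q) (x1 p + x1 q) (x2 p + x2 q).
Definition L3_scal (a : R) (p : L3) : L3 := mkL3 (a * x0 p) (a * x1 p) (a * x2 p).

Definition lor (p q : L3) : R := - (x0 p * x0 q) + x1 p * x1 q + x2 p * x2 q.

Definition det3 (p q r : L3) : R :=
  x0 p * (x1 q * x2 r - x2 q * x1 r)
  - x1 p * (x0 q * x2 r - x2 q * x0 r)
  + x2 p * (x0 q * x1 r - x1 q * x0 r).

Definition H2 (p : L3) : Prop := lor p p = -1 /\ 0 < x0 p.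

(** Elements of L^3 x R serve both as points and as tangent vectors; the last
    coordinate is the one of the factor R. *)
Definition L3R : Type := (L3 * R)%type.

Definition add (w z : L3R) : L3R := (L3_add (fst w) (fst z), snd w + snd z).
Definition scal (a : R) (w : L3R) : L3R := (L3_scal a (fst w), a * snd w).
Definition inner (w z : L3R) : R := lor (fst w) (fst z) + snd w * snd z.

Definition H2R (q : L3R) : Prop := H2 (fst q).

(** The unit normal of H^2 x R in L^3 x R at q = (p, t) is (p, 0), and it is
    timelike. *)
Definition tangent_H2R (q w : L3R) : Prop := lor (fst q) (fst w) = 0.

Definition proj_H2R (q w : L3R) : L3R :=
  (L3_add (fst w) (L3_scal (lor (fst q) (fst w)) (fst q)), snd w).

Definition dt : L3R := (mkL3 0 0 0, 1).

(** [vol q a b c] is the determinant of the four vectors (p, 0), a, b, c of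
    L^3 x R, where q = (p, t), expanded along the R coordinate.  Orientation: a
    basis (a, b) of T_p H^2 is direct when det3 p a b > 0 (so that (d/dx^1, d/dx^2)
    is direct at (1,0,0)), and d/dt is direct in R. *)
Definition vol (q a b c : L3R) : R :=
  snd a * det3 (fst q) (fst b) (fst c)
  - snd b * det3 (fst q) (fst a) (fst c)
  + snd c * det3 (fst q) (fst a) (fst b).

(** Orientation-preserving isometries of H^2: the hyperbolic distance satisfies
    cosh (d p q) = - lor p q, so the first two conditions say that f is an isometry.
    It is then the restriction of a linear isometry A of L^3, which multiplies
    det3 by det A = 1 or -1, the sign being 1 when f preserves the orientation. *)
Definition direct_isometry_H2 (f : L3 -> L3) : Prop :=
  (forall p, H2 p -> H2 (f p)) /\
  (forall p q, H2 p -> H2 q -> lor (f p) (f q) = lor p q) /\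
  (forall p q r, H2 p -> H2 q -> H2 r -> det3 (f p) (f q) (f r) = det3 p q r).

(** Isometries of H^2 x R are products of isometries of the factors; those of R
    that preserve the orientation are the translations. *)
Definition direct_isometry_H2R (F : L3R -> L3R) : Prop :=
  exists (f : L3 -> L3) (c : R),
    direct_isometry_H2 f /\ forall q, F q = (f (fst q), snd q + c).

(** ** Parametrized surfaces over a domain D of the (u, v)-plane *)

Definition domain : Type := R -> R -> Prop.

Definition smooth (D : domain) (f : R -> R -> R) : Prop :=
  forall u v, D u v -> forall n : nat, ex_diff_n f n u v.

Definition smooth_map (D : domain) (x : R -> R -> L3R) : Prop :=
  smooth D (fun u v => x0 (fst (x u v))) /\
  smooth D (fun u v => x1 (fst (x u v))) /\
  smooth D (fun u v => x2 (fst (x u v))) /\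
  smooth D (fun u v => snd (x u v)).

Definition curve_derive (c : R -> L3R) (s : R) : L3R :=
  (mkL3 (Derive (fun r => x0 (fst (c r))) s)
        (Derive (fun r => x1 (fst (c r))) s)
        (Derive (fun r => x2 (fst (c r))) s),
   Derive (fun r => snd (c r)) s).

Definition partial_u (x : R -> R -> L3R) (u v : R) : L3R :=
  curve_derive (fun s => x s v) u.
Definition partial_v (x : R -> R -> L3R) (u v : R) : L3R :=
  curve_derive (fun s => x u s) v.

(** Tangent vectors of the surface are given by their components in the frame
    (d/du, d/dv). *)
Definition tvec : Type := (R * R)%type.

Definition differential (x : R -> R -> L3R) (u v : R) (X : tvec) : L3R :=
  add (scal (fst X) (partial_u x u v)) (scal (snd X) (partial_v x u v)).

(** Levi-Civita connection of H^2 x R along x: the projection on T(H^2 x R) of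
    the flat derivative in L^3 x R. *)
Definition nabla (x N : R -> R -> L3R) (u v : R) (X : tvec) : L3R :=
  proj_H2R (x u v) (differential N u v X).

(** Rotation by pi/2 for any metric conformal to du^2 + dv^2, with z = u + iv
    as direct coordinate. *)
Definition J (X : tvec) : tvec := (- snd X, fst X).

Definition conformal_immersion (D : domain) (x : R -> R -> L3R) : Prop :=
  smooth_map D x /\
  forall u v, D u v ->
    H2R (x u v) /\
    inner (partial_u x u v) (partial_u x u v)
      = inner (partial_v x u v) (partial_v x u v) /\
    inner (partial_u x u v) (partial_v x u v) = 0 /\
    0 < inner (partial_u x u v) (partial_u x u v).

Definition direct_unit_normal (D : domain) (x N : R -> R -> L3R) : Prop :=
  smooth_map D N /\
  forall u v, D u v ->
    tangent_H2R (x u v) (N u v) /\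
    inner (N u v) (N u v) = 1 /\
    inner (N u v) (partial_u x u v) = 0 /\
    inner (N u v) (partial_v x u v) = 0 /\
    0 < vol (x u v) (partial_u x u v) (partial_v x u v) (N u v).

(** The data (ds^2, S, T, nu) of an immersion. *)
Record data := mkData {
  ds2 : R -> R -> tvec -> tvec -> R;
  S_op : R -> R -> tvec -> tvec;
  T_field : R -> R -> tvec;
  nu : R -> R -> R
}.

Definition has_data (D : domain) (x N : R -> R -> L3R) (d : data) : Prop :=
  forall u v, D u v ->
    (forall X Y, ds2 d u v X Y = inner (differential x u v X) (differential x u v Y)) /\
    (forall X, differential x u v (S_op d u v X) = scal (-1) (nabla x N u v X)) /\
    nu d u v = inner (N u v) dt /\
    differential x u v (T_field d u v) = add dt (scal (- nu d u v) (N u v)).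

Definition trace (A : tvec -> tvec) : R := fst (A (1, 0)) + snd (A (0, 1)).

Definition conformal_minimal_immersion (D : domain) (x N : R -> R -> L3R) : Prop :=
  conformal_immersion D x /\
  direct_unit_normal D x N /\
  exists d, has_data D x N d /\ forall u v, D u v -> trace (S_op d u v) = 0.

(** ** Conjugation *)

Definition conjugate_data (d : data) : data :=
  mkData (ds2 d) (fun u v X => J (S_op d u v X)) (fun u v => J (T_field d u v)) (nu d).

Definition conjugate_immersion (D : domain) (x N y M : R -> R -> L3R) : Prop :=
  conformal_minimal_immersion D x N /\
  conformal_minimal_immersion D y M /\
  exists d, has_data D x N d /\ has_data D y M (conjugate_data d).

(** Two parametrizations give the same surface when they differ by an
    orientation-preserving diffeomorphism (P, Q) of the parameter domains, with
    inverse (P', Q'). *)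
Definition same_surface (D : domain) (x : R -> R -> L3R)
    (D' : domain) (x' : R -> R -> L3R) : Prop :=
  exists P Q P' Q' : R -> R -> R,
    smooth D P /\ smooth D Q /\ smooth D' P' /\ smooth D' Q' /\
    (forall u v, D u v ->
       D' (P u v) (Q u v) /\
       P' (P u v) (Q u v) = u /\ Q' (P u v) (Q u v) = v /\
       0 < Derive (fun s => P s v) u * Derive (fun s => Q u s) v
           - Derive (fun s => P u s) v * Derive (fun s => Q s v) u /\
       x u v = x' (P u v) (Q u v)) /\
    (forall u v, D' u v ->
       D (P' u v) (Q' u v) /\
       P (P' u v) (Q' u v) = u /\ Q (P' u v) (Q' u v) = v).

(** The surface parametrized by x' on D' is the conjugate surface of x: a
    conjugate immersion of x exists, and every one parametrizes that surface up
    to an isometry preserving the orientations of H^2 and of R. *)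
Definition conjugate_surface (D : domain) (x N : R -> R -> L3R)
    (D' : domain) (x' : R -> R -> L3R) : Prop :=
  (exists y M, conjugate_immersion D x N y M) /\
  (forall y M, conjugate_immersion D x N y M ->
     exists F, direct_isometry_H2R F /\
       same_surface D (fun u v => F (y u v)) D' x').

(** ** Helicoids and generalized catenoids *)

Definition in_interval (a b : Rbar) (u : R) : Prop := Rbar_lt a u /\ Rbar_lt u b.

Definition strip (a b : Rbar) : domain := fun u _ => in_interval a b u.

(** [sol a b f] says that f is a solution on the open interval (a, b); the values
    of f outside (a, b) are irrelevant. *)
Definition maximal_solution (sol : Rbar -> Rbar -> (R -> R) -> Prop)
    (a b : Rbar) (f : R -> R) : Prop :=
  sol a b f /\
  forall (a' b' : Rbar) (g : R -> R),
    Rbar_le a' a -> Rbar_le b b' -> sol a' b' g ->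
    (forall u, in_interval a b u -> g u = f u) ->
    a' = a /\ b' = b.

Definition helicoid_ode (beta : R) (a b : Rbar) (phi : R -> R) : Prop :=
  in_interval a b 0 /\ phi 0 = 0 /\
  forall u, in_interval a b u ->
    ex_derive phi u /\
    Derive phi u ^ 2 = 1 + beta ^ 2 * sinh (phi u) ^ 2 /\
    is_derive (Derive phi) u (beta ^ 2 * sinh (phi u) * cosh (phi u)) /\
    0 < Derive phi u.

Definition helicoid (beta : R) (phi : R -> R) (u v : R) : L3R :=
  (mkL3 (cosh (phi u))
        (sinh (phi u) * cos (beta * v))
        (sinh (phi u) * sin (beta * v)),
   v).

Definition catenoid_ode (gamma : R) (a b : Rbar) (chi : R -> R) : Prop :=
  in_interval a b 0 /\ Derive chi 0 = 0 /\
  forall u, in_interval a b u ->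
    ex_derive chi u /\
    1 + Derive chi u ^ 2 = gamma ^ 2 * cosh (chi u) ^ 2 /\
    is_derive (Derive chi) u (gamma ^ 2 * cosh (chi u) * sinh (chi u)) /\
    0 < chi u.

Definition catenoid (gamma : R) (chi : R -> R) (u v : R) : L3R :=
  (mkL3 (cosh (chi u) * cosh (gamma * v))
        (sinh (chi u))
        (cosh (chi u) * sinh (gamma * v)),
   u).

Definition catenoid_normal (gamma : R) (chi : R -> R) (u v : R) : L3R :=
  scal (- / (gamma * cosh (chi u)))
    (mkL3 (sinh (chi u) * cosh (gamma * v))
          (cosh (chi u))
          (sinh (chi u) * sinh (gamma * v)),
     - Derive chi u).

(* Main.v *)
(** Up to the common sign of beta and gamma, the profiles are related by
    phi' = gamma cosh chi, chi' = beta sinh phi, beta cosh phi = gamma sinh chi.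
    These relations turn a solution of one profile equation into a solution of
    the other, so the two maximal intervals coincide, and they show that in the
    same coordinates (u, v) the helicoid has exactly the data conjugate to those
    of the catenoid.

    For uniqueness, let y = (p, t) be any immersion with these data and unit
    normal M.  The data force t = v + const, and p_u / phi' and - phi' M_h (with
    M_h the L^3 component of M) complete p to a direct Lorentz-orthonormal frame
    whose derivatives have the same coefficients as for the helicoid.  The
    helicoid's frame, inverted, thus gives three constant vectors, and taking
    coordinates in that constant frame is the required isometry of H^2. *)
Require Import Defs.
From Stdlib Require Import Reals Lra Nsatz.
From Coquelicot Require Import Coquelicot.
Open Scope R_scope.

(* [nsatz] treats [pow] as opaque, and misses the hypotheses above an inequality. *)
Ltac pow_nsatz := cbn [pow] in *; nsatz.

(** * Profile curves *)

(** The comparison of the maximal intervals is carried out on the helicoid side. There phi' > 0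
    reduces the profile equation to phi' = sqrt (1 + beta^2 sinh^2 phi), whose right-hand side never
    vanishes, so separation of variables gives uniqueness and solutions can be glued. For the
    catenoid, chi'(0) = 0: the corresponding first-order equation degenerates exactly at the initial
    point. Statements about chi are therefore transported through the correspondence of profiles.

    In the rigidity argument the data control only first derivatives of y and M, whereas the frame
    vector e = p_u / phi' already contains a first derivative of y. Its derivatives are recovered
    from e = f x p, with the Lorentzian cross product, since p and f = - phi' M_h have known first
    derivatives.

    [conjugate_immersion] hides its data behind an existential, so explicit formulas can be used
    only once the data are known to be determined by the immersion and its normal. *)

Lemma in_interval_locally (a b : Rbar) (u : R) :
  in_interval a b u -> locally u (in_interval a b).
Proof.
  intros [Ha Hb]. apply (locally_interval _ u a b Ha Hb).
  intros y Hya Hyb. now split.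
Qed.

Lemma in_interval_convex (a b : Rbar) (r s t : R) :
  in_interval a b r -> in_interval a b t -> Rmin r t <= s <= Rmax r t ->
  in_interval a b s.
Proof.
  intros [Hr1 Hr2] [Ht1 Ht2] [H1 H2].
  split; destruct a, b; simpl in *; trivial;
    revert H1 H2; unfold Rmin, Rmax; destruct (Rle_dec r t); lra.
Qed.

Lemma is_derive_zero_const (a b : Rbar) (f : R -> R) (s t : R) :
  (forall u, in_interval a b u -> is_derive f u 0) ->
  in_interval a b s -> in_interval a b t -> f t = f s.
Proof.
  intros Hf Hs Ht.
  destruct (MVT_gen f s t (fun _ => 0)) as [r [_ Hr]].
  - intros x Hx. apply Hf, (in_interval_convex a b s x t); lra || trivial.
  - intros x Hx.
    apply derivable_continuous_pt. exists 0.
    apply is_derive_Reals, Hf, (in_interval_convex a b s x t); trivial.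
  - lra.
Qed.

Lemma cosh_pos (x : R) : 0 < cosh x.
Proof. unfold cosh. generalize (exp_pos x) (exp_pos (- x)). lra. Qed.

Lemma cosh_sqr (x : R) : cosh x ^ 2 = 1 + sinh x ^ 2.
Proof.
  assert (H : exp x * exp (- x) = 1) by (rewrite <- exp_plus, Rplus_opp_r; apply exp_0).
  apply Rminus_diag_uniq. transitivity (exp x * exp (- x) - 1); [|lra].
  unfold cosh, sinh. field.
Qed.

(** The profiles are built as arcsinh of known functions. Keeping cosh (arcsinh _) in place of a
    square root lets the derivative be simplified by the relations between cosh and sinh of the two
    profiles. *)
Lemma is_derive_arcsinh_comp (w : R -> R) (u dw : R) :
  is_derive w u dw ->
  is_derive (fun s => arcsinh (w s)) u (dw / cosh (arcsinh (w u))).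
Proof.
  intros Hw.
  assert (Hc : cosh (arcsinh (w u)) = sqrt (w u ^ 2 + 1)).
  { symmetry. apply sqrt_lem_1.
    - generalize (pow2_ge_0 (w u)). lra.
    - apply Rlt_le, cosh_pos.
    - generalize (cosh_sqr (arcsinh (w u))). rewrite sinh_arcsinh. lra. }
  rewrite Hc.
  apply (is_derive_comp arcsinh w); [|exact Hw].
  apply is_derive_Reals, derivable_pt_lim_arcsinh.
Qed.

Lemma Rsqr_pos_inj (x y : R) : 0 < x -> 0 < y -> x ^ 2 = y ^ 2 -> x = y.
Proof. intros Hx Hy H. nra. Qed.

(* G (phi u) - u is constant along every helicoid profile phi, which gives uniqueness
   without the Cauchy-Lipschitz theorem. *)
Lemma helicoid_time (beta : R) :
  exists G : R -> R, forall x, is_derive G x (/ sqrt (1 + beta ^ 2 * sinh x ^ 2)).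
Proof.
  set (g := fun x => / sqrt (1 + beta ^ 2 * sinh x ^ 2)).
  assert (Hc : forall x, continuous g x).
  { intros x. apply (ex_derive_continuous g). unfold g.
    assert (0 < 1 + beta ^ 2 * sinh x ^ 2).
    { generalize (pow2_ge_0 (beta * sinh x)). nra. }
    auto_derive. repeat split; trivial.
    apply Rgt_not_eq, sqrt_lt_R0. simpl in *. lra. }
  exists (fun x => RInt g 0 x). intros x.
  apply (is_derive_RInt g (fun x => RInt g 0 x) 0 x); [|apply Hc].
  apply filter_forall. intros y. apply (RInt_correct g).
  apply (ex_RInt_continuous g). intros z _. apply Hc.
Qed.

(** Both values have the same image u + G 0 under the time function G, which is strictly increasing
    and hence injective. *)
Lemma helicoid_ode_unique (beta : R) (a b a' b' : Rbar) (f g : R -> R) (u : R) :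
  helicoid_ode beta a b f -> helicoid_ode beta a' b' g ->
  in_interval a b u -> in_interval a' b' u -> f u = g u.
Proof.
  intros Hf Hg Hu Hu'.
  destruct (helicoid_time beta) as [G HG].
  assert (Hpos : forall x, 0 < / sqrt (1 + beta ^ 2 * sinh x ^ 2)).
  { intros x. apply Rinv_0_lt_compat, sqrt_lt_R0.
    generalize (pow2_ge_0 (beta * sinh x)). nra. }
  assert (Hinc : forall x y, x < y -> G x < G y).
  { intros x y Hxy.
    destruct (MVT_gen G x y (fun x => / sqrt (1 + beta ^ 2 * sinh x ^ 2)))
      as [r [_ Hr]].
    - intros z _. apply HG.
    - intros z _. apply derivable_continuous_pt. exists (/ sqrt (1 + beta ^ 2 * sinh z ^ 2)).
      apply is_derive_Reals, HG.
    - specialize (Hpos r). nra. }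
  assert (Htime : forall (c d : Rbar) h s, helicoid_ode beta c d h -> in_interval c d s ->
            G (h s) = s + G 0).
  { intros c d h s [H0 [Hh0 Hh]] Hs.
    enough (G (h s) - s = G (h 0) - 0) by (rewrite Hh0 in *; lra).
    apply (is_derive_zero_const c d (fun r => G (h r) - r) 0 s); trivial.
    intros r Hr. destruct (Hh r Hr) as [Hd [Hsq [_ Hp]]].
    auto_derive.
    - repeat split; [exists (/ sqrt (1 + beta ^ 2 * sinh (h r) ^ 2)); apply HG|exact Hd].
    - replace (Derive (fun x => G x) (h r)) with (/ sqrt (1 + beta ^ 2 * sinh (h r) ^ 2))
        by (symmetry; apply is_derive_unique, HG).
      replace (Derive (fun x => h x) r) with (Derive h r) by reflexivity.
      (* The positivity of h' selects h' as the square root, so the derivative of G (h r) - r is h'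
         / h' - 1. *)
      rewrite <- Hsq, sqrt_pow2 by lra. field. lra. }
  generalize (Htime a b f u Hf Hu) (Htime a' b' g u Hg Hu'). intros E1 E2.
  destruct (Rtotal_order (f u) (g u)) as [H|[H|H]]; trivial;
    apply Hinc in H; lra.
Qed.

(** Two open intervals containing 0 have an interval as union, with the smaller left end and the
    larger right end. The conclusion has the shape that [maximal_solution] asks of an extension of
    g. *)
Lemma helicoid_ode_glue (beta : R) (a b c d : Rbar) (f g : R -> R) :
  helicoid_ode beta a b f -> helicoid_ode beta c d g ->
  exists l r h, Rbar_le l a /\ Rbar_le l c /\ Rbar_le b r /\ Rbar_le d r /\
    helicoid_ode beta l r h /\ forall u, in_interval c d u -> h u = g u.
Proof.
  intros Hf Hg.
  assert (Hl : exists l, Rbar_le l a /\ Rbar_le l c /\ (l = a \/ l = c)).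
  { destruct (Rbar_le_lt_dec a c) as [H|H]; [exists a|exists c];
      auto using Rbar_le_refl, Rbar_lt_le. }
  assert (Hr : exists r, Rbar_le b r /\ Rbar_le d r /\ (r = b \/ r = d)).
  { destruct (Rbar_le_lt_dec b d) as [H|H]; [exists d|exists b];
      auto using Rbar_le_refl, Rbar_lt_le. }
  destruct Hl as [l [Hla [Hlc Hl]]]. destruct Hr as [r [Hbr [Hdr Hr]]].
  exists l, r.
  set (P := fun u : R => Rbar_lt a u /\ Rbar_lt u b).
  assert (HP : forall u, {P u} + {~ P u}).
  { intros u. unfold P. destruct (Rbar_lt_dec a u), (Rbar_lt_dec u b); tauto. }
  set (h := fun u : R => if HP u then f u else g u).
  assert (Hhf : forall u, in_interval a b u -> h u = f u).
  { intros u Hu. unfold h. destruct (HP u); tauto. }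
  assert (Hhg : forall u, in_interval c d u -> h u = g u).
  { intros u Hu. unfold h. destruct (HP u); trivial.
    now apply (helicoid_ode_unique beta a b c d). }
  exists h. do 4 (split; [assumption|]). split; [|exact Hhg].
  (* Every clause of the equation is local, so it passes from [k] to [h] on an open interval where
     they agree. *)
  assert (Hloc : forall (p q : Rbar) k u, helicoid_ode beta p q k ->
     (forall s, in_interval p q s -> h s = k s) -> in_interval p q u ->
     ex_derive h u /\
    Derive h u ^ 2 = 1 + beta ^ 2 * sinh (h u) ^ 2 /\
    is_derive (Derive h) u (beta ^ 2 * sinh (h u) * cosh (h u)) /\
    0 < Derive h u).
  { intros p q k u [_ [_ Hk]] Hhk Hu.
    assert (HD : forall s, in_interval p q s -> Derive h s = Derive k s).
    { intros s Hs. apply Derive_ext_loc.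
      generalize (in_interval_locally p q s Hs). apply filter_imp. exact Hhk. }
    destruct (Hk u Hu) as [H1 [H2 [H3 H4]]].
    rewrite (HD u Hu), (Hhk u Hu). split; [|split; [|split]]; trivial.
    - apply (ex_derive_ext_loc k); trivial.
      generalize (in_interval_locally p q u Hu). apply filter_imp.
      intros s Hs. symmetry. now apply Hhk.
    - apply (is_derive_ext_loc (Derive k)); trivial.
      generalize (in_interval_locally p q u Hu). apply filter_imp.
      intros s Hs. symmetry. now apply HD. }
  assert (Hf0 := proj1 Hf). assert (Hg0 := proj1 Hg).
  (* Since 0 lies in both intervals, the upper bounds are automatic for u <= 0 and the lower ones
     for u > 0; the remaining bound holds for one of the two intervals. *)
  assert (Hcover : forall u, in_interval l r u ->
            in_interval a b u \/ in_interval c d u).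
  { clear - Hf0 Hg0 Hl Hr. intros u [H1 H2]. destruct Hf0, Hg0.
    assert (L : Rbar_lt a u \/ Rbar_lt c u)
      by (destruct Hl as [<-|<-]; tauto).
    assert (U : Rbar_lt u b \/ Rbar_lt u d)
      by (destruct Hr as [<-|<-]; tauto).
    unfold in_interval.
    destruct (Rle_lt_dec u 0) as [Hu|Hu].
    - assert (Rbar_lt u b /\ Rbar_lt u d).
      { split; [apply Rbar_le_lt_trans with 0|apply Rbar_le_lt_trans with 0]; trivial. }
      tauto.
    - assert (Rbar_lt a u /\ Rbar_lt c u).
      { split; [apply Rbar_lt_trans with 0|apply Rbar_lt_trans with 0]; trivial. }
      tauto. }
  split; [|split].
  - destruct Hf0, Hg0. split; [now destruct Hl as [->| ->]|now destruct Hr as [->| ->]].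
  - rewrite Hhf by trivial. apply Hf.
  - intros u Hu. destruct (Hcover u Hu) as [H|H];
      [apply (Hloc a b f u)|apply (Hloc c d g u)]; trivial.
Qed.

(** * Correspondence between the two profile equations *)

Definition conjugate_profiles (beta gamma : R) (a b : Rbar) (chi phi : R -> R) : Prop :=
  forall u, in_interval a b u ->
    Derive phi u = gamma * cosh (chi u) /\
    Derive chi u = beta * sinh (phi u) /\
    beta * cosh (phi u) = gamma * sinh (chi u).

Lemma sinh_pos (x : R) : 0 < x -> 0 < sinh x.
Proof. intros H. rewrite <- sinh_0. now apply sinh_lt. Qed.

(** The relation chi' = beta sinh phi defines phi. Squaring gives beta^2 cosh^2 phi = beta^2 +
    chi'^2 = gamma^2 sinh^2 chi, and chi > 0 fixes the sign of the root. Differentiating the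
    defining relation and comparing with chi'' then yields phi'. *)
Lemma helicoid_profile_of_catenoid (beta gamma : R) (a b : Rbar) (chi : R -> R) :
  0 < beta -> 0 < gamma -> beta ^ 2 + gamma ^ 2 = 1 ->
  catenoid_ode gamma a b chi ->
  exists phi, helicoid_ode beta a b phi /\ conjugate_profiles beta gamma a b chi phi.
Proof.
  intros Hb Hg H1 [H0 [Hchi0 Hchi]].
  set (phi := fun u => arcsinh (Derive chi u / beta)). exists phi.
  assert (Hsh : forall u, beta * sinh (phi u) = Derive chi u).
  { intros u. unfold phi. rewrite sinh_arcsinh. field. lra. }
  assert (Hch : forall u, in_interval a b u -> beta * cosh (phi u) = gamma * sinh (chi u)).
  { intros u Hu. destruct (Hchi u Hu) as [_ [E [_ P]]].
    apply Rsqr_pos_inj.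
    - generalize (cosh_pos (phi u)). nra.
    - generalize (sinh_pos (chi u) P). nra.
    - generalize (cosh_sqr (phi u)) (cosh_sqr (chi u)) (Hsh u). clear - E H1.
      intros; pow_nsatz. }
  assert (Hd : forall u, in_interval a b u -> is_derive phi u (gamma * cosh (chi u))).
  { intros u Hu. destruct (Hchi u Hu) as [_ [_ [E P]]].
    assert (W : is_derive (fun u => Derive chi u / beta) u
                  (gamma ^ 2 * cosh (chi u) * sinh (chi u) / beta)).
    { apply (is_derive_ext (fun u => / beta * Derive chi u)).
      - intros t. unfold Rdiv. apply Rmult_comm.
      - replace (gamma ^ 2 * cosh (chi u) * sinh (chi u) / beta)
          with (/ beta * (gamma ^ 2 * cosh (chi u) * sinh (chi u))) by (field; lra).
        now apply (is_derive_scal (Derive chi)). }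
    apply is_derive_arcsinh_comp in W. fold (phi u) in W.
    replace (gamma * cosh (chi u)) with
      (gamma ^ 2 * cosh (chi u) * sinh (chi u) / beta / cosh (phi u)); [exact W|].
    specialize (Hch u Hu). generalize (cosh_pos (phi u)). intros.
    apply Rmult_eq_reg_r with (beta * cosh (phi u)); [|nra].
    transitivity (gamma ^ 2 * cosh (chi u) * sinh (chi u)); [field; lra|].
    rewrite Hch. ring. }
  assert (HD : forall u, in_interval a b u -> Derive phi u = gamma * cosh (chi u))
    by (intros u Hu; now apply is_derive_unique, Hd).
  split; [split; [exact H0|split]|].
  - unfold phi. rewrite Hchi0. unfold Rdiv. rewrite Rmult_0_l. apply arcsinh_0.
  - intros u Hu. destruct (Hchi u Hu) as [X [E [F P]]].
    generalize (Hsh u) (Hch u Hu). intros S C. split; [|split; [|split]].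
    + eexists; now apply Hd.
    + rewrite HD by trivial. clear - E S. pow_nsatz.
    + apply (is_derive_ext_loc (fun u => gamma * cosh (chi u))).
      * generalize (in_interval_locally a b u Hu). apply filter_imp.
        intros s Hs. symmetry. now apply HD.
      * auto_derive; trivial.
        change (Derive (fun x => chi x) u) with (Derive chi u).
        rewrite <- S. clear - C. pow_nsatz.
    + rewrite HD by trivial. generalize (cosh_pos (chi u)). nra.
  - intros u Hu. repeat split; auto.
Qed.

(** Here chi is defined by the relation without derivatives, beta cosh phi = gamma sinh chi, which
    also makes it positive. Then gamma^2 cosh^2 chi = gamma^2 + beta^2 cosh^2 phi = phi'^2, and phi'
    > 0 fixes the sign of the root. *)
Lemma catenoid_profile_of_helicoid (beta gamma : R) (a b : Rbar) (phi : R -> R) :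
  0 < beta -> 0 < gamma -> beta ^ 2 + gamma ^ 2 = 1 ->
  helicoid_ode beta a b phi ->
  exists chi, catenoid_ode gamma a b chi /\ conjugate_profiles beta gamma a b chi phi.
Proof.
  intros Hb Hg H1 [H0 [Hphi0 Hphi]].
  set (chi := fun u => arcsinh (beta * cosh (phi u) / gamma)). exists chi.
  assert (Hch : forall u, beta * cosh (phi u) = gamma * sinh (chi u)).
  { intros u. unfold chi. rewrite sinh_arcsinh. field. lra. }
  assert (HD : forall u, in_interval a b u -> Derive phi u = gamma * cosh (chi u)).
  { intros u Hu. destruct (Hphi u Hu) as [_ [E [_ P]]].
    apply Rsqr_pos_inj; trivial.
    - generalize (cosh_pos (chi u)). nra.
    - generalize (cosh_sqr (phi u)) (cosh_sqr (chi u)) (Hch u). clear - E H1.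
      intros; pow_nsatz. }
  assert (Hd : forall u, in_interval a b u -> is_derive chi u (beta * sinh (phi u))).
  { intros u Hu. destruct (Hphi u Hu) as [X [_ [E P]]].
    assert (W : is_derive (fun u => beta * cosh (phi u) / gamma) u
                  (beta * (Derive phi u * sinh (phi u)) / gamma)).
    { auto_derive; trivial.
      change (Derive (fun x => phi x) u) with (Derive phi u). field. lra. }
    apply is_derive_arcsinh_comp in W. fold (chi u) in W.
    replace (beta * sinh (phi u)) with
      (beta * (Derive phi u * sinh (phi u)) / gamma / cosh (chi u)); [exact W|].
    rewrite HD by trivial.
    generalize (cosh_pos (chi u)). intros. field. lra. }
  assert (HE : forall u, in_interval a b u -> Derive chi u = beta * sinh (phi u))
    by (intros u Hu; now apply is_derive_unique, Hd).
  split; [split; [exact H0|split]|].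
  - rewrite HE, Hphi0, sinh_0 by trivial. ring.
  - intros u Hu. destruct (Hphi u Hu) as [X [E [F P]]].
    generalize (Hch u) (HD u Hu). intros C D. split; [|split; [|split]].
    + eexists; now apply Hd.
    + rewrite HE by trivial. clear - E D. pow_nsatz.
    + apply (is_derive_ext_loc (fun u => beta * sinh (phi u))).
      * generalize (in_interval_locally a b u Hu). apply filter_imp.
        intros s Hs. symmetry. now apply HE.
      * auto_derive; trivial.
        change (Derive (fun x => phi x) u) with (Derive phi u).
        rewrite D. clear - C. pow_nsatz.
    + apply Rnot_le_lt. intros Hn.
      assert (sinh (chi u) <= 0).
      { destruct Hn as [Hn|Hn]; [rewrite <- sinh_0; now apply Rlt_le, sinh_lt|].
        rewrite Hn, sinh_0. lra. }
      generalize (cosh_pos (phi u)). nra.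
  - intros u Hu. repeat split; auto.
Qed.

(** Each maximality gives one inclusion: that of phi puts (a, b) inside (c, d), and that of chi
    forbids the catenoid profile built from phi on (c, d) from being a proper extension. *)
Lemma maximal_profiles (beta gamma : R) (a b c d : Rbar) (chi phi : R -> R) :
  0 < beta -> 0 < gamma -> beta ^ 2 + gamma ^ 2 = 1 ->
  maximal_solution (catenoid_ode gamma) a b chi ->
  maximal_solution (helicoid_ode beta) c d phi ->
  a = c /\ b = d /\ conjugate_profiles beta gamma a b chi phi.
Proof.
  intros Hb Hg H1 [Hchi Mchi] [Hphi Mphi].
  destruct (helicoid_profile_of_catenoid beta gamma a b chi) as [f [Hf Cf]]; trivial.
  destruct (helicoid_ode_glue beta a b c d f phi Hf Hphi)
    as [l [r [h [Hca [Hlc [Hbd [Hdr [Hh Ehg]]]]]]]].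
  (* The glued solution extends phi, so it cannot live on a larger interval; hence (a, b) lies
     inside (c, d). *)
  destruct (Mphi l r h) as [-> ->]; trivial.
  destruct (catenoid_profile_of_helicoid beta gamma c d phi) as [k [Hk Ck]]; trivial.
  assert (Hsub : forall u, in_interval a b u -> in_interval c d u).
  { intros u [Hu1 Hu2]. split.
    - now apply Rbar_le_lt_trans with a.
    - now apply Rbar_lt_le_trans with b. }
  assert (Hfp : forall u, in_interval a b u -> f u = phi u).
  { intros u Hu. apply (helicoid_ode_unique beta a b c d f phi u); auto. }
  (* Both have the same sinh, since [f] and [phi] agree here. *)
  assert (Hkc : forall u, in_interval a b u -> k u = chi u).
  { intros u Hu.
    destruct (Cf u Hu) as [_ [_ E3]]. destruct (Ck u (Hsub u Hu)) as [_ [_ E4]].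
    rewrite (Hfp u Hu), E4 in E3. apply Rmult_eq_reg_l in E3; [|lra].
    rewrite <- (arcsinh_sinh (k u)), E3. apply arcsinh_sinh. }
  destruct (Mchi c d k Hca Hbd Hk Hkc) as [-> ->].
  repeat split; destruct (Cf u H) as [D1 [D2 D3]].
  - rewrite <- D1. apply Derive_ext_loc.
    generalize (in_interval_locally a b u H). apply filter_imp.
    intros s Hs. symmetry. auto.
  - rewrite <- Hfp; trivial.
  - rewrite <- Hfp; trivial.
Qed.
(** * Smoothness *)

Definition open_domain (D : Defs.domain) : Prop :=
  forall u v : R, D u v -> locally_2d D u v.

Lemma strip_open (a b : Rbar) : open_domain (strip a b).
Proof.
  intros u v H. destruct (in_interval_locally a b u H) as [eps He].
  exists eps. intros s t Hs _. apply He, Hs.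
Qed.

(** The order is fixed because closure under products and inverses, and regularity of solutions, are
    proved by induction on it. *)
Definition smooth_n (D : Defs.domain) (n : nat) (f : R -> R -> R) : Prop :=
  forall u v, D u v -> ex_diff_n f n u v.

Lemma smooth_n_pred (D : Defs.domain) (n : nat) (f : R -> R -> R) :
  smooth_n D (S n) f -> smooth_n D n f.
Proof. intros H u v Huv. apply (ex_diff_n_m (S n)); auto. Qed.

Lemma smooth_n_ext (D : Defs.domain) (n : nat) (f g : R -> R -> R) :
  open_domain D -> (forall u v, D u v -> f u v = g u v) ->
  smooth_n D n f -> smooth_n D n g.
Proof.
  intros HD E Hf u v Huv. apply (ex_diff_n_ext_loc f); [|now apply Hf].
  destruct (HD u v Huv) as [eps H]. exists eps. auto.
Qed.

(** [ex_diff_n] speaks of the [Derive] functions near the point; openness of D allows explicit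
    partial derivatives to be substituted for them. *)
Lemma smooth_n_S (D : Defs.domain) (n : nat) (f fu fv : R -> R -> R) :
  open_domain D ->
  (forall u v, D u v -> continuity_2d_pt f u v) ->
  (forall u v, D u v -> is_derive (fun s => f s v) u (fu u v)) ->
  (forall u v, D u v -> is_derive (fun s => f u s) v (fv u v)) ->
  smooth_n D n fu -> smooth_n D n fv -> smooth_n D (S n) f.
Proof.
  intros HD Hc Hu Hv Su Sv u v Huv. split; [|split; [|split; [|split]]].
  - now apply Hc.
  - eexists. now apply Hu.
  - eexists. now apply Hv.
  - apply (smooth_n_ext D n fu); trivial.
    intros s t Hst. symmetry. now apply is_derive_unique, Hu.
  - apply (smooth_n_ext D n fv); trivial.
    intros s t Hst. symmetry. now apply is_derive_unique, Hv.
Qed.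

Lemma smooth_n_derive (D : Defs.domain) (n : nat) (f : R -> R -> R) :
  smooth_n D (S n) f ->
  (forall u v, D u v -> is_derive (fun s => f s v) u (Derive (fun s => f s v) u)) /\
  (forall u v, D u v -> is_derive (fun s => f u s) v (Derive (fun s => f u s) v)) /\
  smooth_n D n (fun u v => Derive (fun s => f s v) u) /\
  smooth_n D n (fun u v => Derive (fun s => f u s) v).
Proof.
  intros H. split; [|split; [|split]]; intros u v Huv;
    destruct (H u v Huv) as [_ [H1 [H2 [H3 H4]]]]; trivial;
    now apply Derive_correct.
Qed.

Lemma smooth_n_const (D : Defs.domain) (n : nat) (k : R) :
  open_domain D -> smooth_n D n (fun _ _ => k).
Proof.
  intros HD. revert k. induction n as [|n IH]; intros k.
  - intros u v _. split; trivial. apply continuity_2d_pt_const.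
  - apply (smooth_n_S D n _ (fun _ _ => 0) (fun _ _ => 0)); auto;
      intros; apply continuity_2d_pt_const || apply (is_derive_const k).
Qed.

Lemma smooth_n_plus (D : Defs.domain) (n : nat) (f g : R -> R -> R) :
  open_domain D -> smooth_n D n f -> smooth_n D n g ->
  smooth_n D n (fun u v => f u v + g u v).
Proof.
  intros HD. revert f g. induction n as [|n IH]; intros f g Hf Hg.
  - intros u v H. split; trivial.
    apply continuity_2d_pt_plus; [apply (Hf u v H)|apply (Hg u v H)].
  - destruct (smooth_n_derive D n f Hf) as [F1 [F2 [F3 F4]]].
    destruct (smooth_n_derive D n g Hg) as [G1 [G2 [G3 G4]]].
    eapply smooth_n_S; trivial.
    + intros u v H. apply continuity_2d_pt_plus; [apply (Hf u v H)|apply (Hg u v H)].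
    + intros u v H. apply @is_derive_plus; [now apply F1|now apply G1].
    + intros u v H. apply @is_derive_plus; [now apply F2|now apply G2].
    + now apply IH.
    + now apply IH.
Qed.

Lemma smooth_n_mult (D : Defs.domain) (n : nat) (f g : R -> R -> R) :
  open_domain D -> smooth_n D n f -> smooth_n D n g ->
  smooth_n D n (fun u v => f u v * g u v).
Proof.
  intros HD. revert f g. induction n as [|n IH]; intros f g Hf Hg.
  - intros u v H. split; trivial.
    apply continuity_2d_pt_mult; [apply (Hf u v H)|apply (Hg u v H)].
  - destruct (smooth_n_derive D n f Hf) as [F1 [F2 [F3 F4]]].
    destruct (smooth_n_derive D n g Hg) as [G1 [G2 [G3 G4]]].
    apply smooth_n_pred in Hf as Hf'. apply smooth_n_pred in Hg as Hg'.
    eapply smooth_n_S; trivial.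
    + intros u v H. apply continuity_2d_pt_mult; [apply (Hf u v H)|apply (Hg u v H)].
    + intros u v H.
      apply (is_derive_mult (fun s => f s v) (fun s => g s v));
        [now apply F1|now apply G1|apply Rmult_comm].
    + intros u v H.
      apply (is_derive_mult (fun s => f u s) (fun s => g u s));
        [now apply F2|now apply G2|apply Rmult_comm].
    + apply smooth_n_plus; trivial; apply IH; trivial.
    + apply smooth_n_plus; trivial; apply IH; trivial.
Qed.

Lemma smooth_n_inv (D : Defs.domain) (n : nat) (f : R -> R -> R) :
  open_domain D -> (forall u v, D u v -> f u v <> 0) ->
  smooth_n D n f -> smooth_n D n (fun u v => / f u v).
Proof.
  intros HD H0. induction n as [|n IH]; intros Hf.
  - intros u v H. split; trivial.
    apply continuity_2d_pt_inv; [apply (Hf u v H)|auto].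
  - destruct (smooth_n_derive D n f Hf) as [F1 [F2 [F3 F4]]].
    apply smooth_n_pred in Hf as Hf'. specialize (IH Hf').
    (* The partials are written as products containing 1/f itself, to which the induction hypothesis
       applies at order n. *)
    apply (smooth_n_S D n _
      (fun u v => (-1) * Derive (fun s => f s v) u * (/ f u v * / f u v))
      (fun u v => (-1) * Derive (fun s => f u s) v * (/ f u v * / f u v))); trivial.
    + intros u v H. apply continuity_2d_pt_inv; [apply (Hf u v H)|auto].
    + intros u v H. generalize (H0 u v H). intros Hn.
      replace (-1 * Derive (fun s => f s v) u * (/ f u v * / f u v))
        with (- Derive (fun s => f s v) u / f u v ^ 2) by (field; trivial).
      apply (is_derive_inv (fun s => f s v)); auto.
    + intros u v H. generalize (H0 u v H). intros Hn.
      replace (-1 * Derive (fun s => f u s) v * (/ f u v * / f u v))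
        with (- Derive (fun s => f u s) v / f u v ^ 2) by (field; trivial).
      apply (is_derive_inv (fun s => f u s)); auto.
    + repeat apply smooth_n_mult; trivial. now apply smooth_n_const.
    + repeat apply smooth_n_mult; trivial. now apply smooth_n_const.
Qed.

Lemma smooth_n_fun_u (a b : Rbar) (n : nat) (f df : R -> R) :
  (forall u, in_interval a b u -> is_derive f u (df u)) ->
  smooth_n (strip a b) n (fun u _ => df u) ->
  smooth_n (strip a b) (S n) (fun u _ => f u).
Proof.
  intros Hf Hdf. apply (smooth_n_S _ _ _ (fun u _ => df u) (fun _ _ => 0)); trivial.
  - apply strip_open.
  - intros u v H. apply (continuity_1d_2d_pt_comp f (fun u _ => u)).
    + apply derivable_continuous_pt. exists (df u). apply is_derive_Reals. now apply Hf.
    + apply continuity_2d_pt_id1.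
  - intros u v H. now apply Hf.
  - intros u v H. apply (is_derive_const (f u)).
  - apply smooth_n_const, strip_open.
Qed.

Lemma smooth_n_fun_v (a b : Rbar) (n : nat) (f df : R -> R) :
  (forall v, is_derive f v (df v)) ->
  smooth_n (strip a b) n (fun _ v => df v) ->
  smooth_n (strip a b) (S n) (fun _ v => f v).
Proof.
  intros Hf Hdf. apply (smooth_n_S _ _ _ (fun _ _ => 0) (fun _ v => df v)); trivial.
  - apply strip_open.
  - intros u v H. apply (continuity_1d_2d_pt_comp f (fun _ v => v)).
    + apply derivable_continuous_pt. exists (df v). apply is_derive_Reals. now apply Hf.
    + apply continuity_2d_pt_id2.
  - intros u v H. apply (is_derive_const (f v)).
  - apply smooth_n_const, strip_open.
Qed.

Lemma smooth_equiv (D : Defs.domain) (f : R -> R -> R) :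
  smooth D f <-> forall n, smooth_n D n f.
Proof. unfold smooth, smooth_n. split; auto. Qed.

Lemma smooth_mult (D : Defs.domain) (f g : R -> R -> R) :
  open_domain D -> smooth D f -> smooth D g -> smooth D (fun u v => f u v * g u v).
Proof.
  rewrite !smooth_equiv. intros HD Hf Hg n. now apply smooth_n_mult.
Qed.

Lemma smooth_const (D : Defs.domain) (k : R) :
  open_domain D -> smooth D (fun _ _ => k).
Proof. intros HD. apply smooth_equiv. intros n. now apply smooth_n_const. Qed.

Lemma smooth_inv (D : Defs.domain) (f : R -> R -> R) :
  open_domain D -> (forall u v, D u v -> f u v <> 0) ->
  smooth D f -> smooth D (fun u v => / f u v).
Proof. rewrite !smooth_equiv. intros HD H0 Hf n. now apply smooth_n_inv. Qed.

Lemma smooth_u (a b : Rbar) : smooth (strip a b) (fun u _ => u).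
Proof.
  apply smooth_equiv. intros [|n].
  - intros u v _. split; trivial. apply continuity_2d_pt_id1.
  - apply (smooth_n_fun_u a b n (fun u => u) (fun _ => 1)).
    + intros u _. apply (is_derive_id u).
    + apply smooth_n_const, strip_open.
Qed.

Lemma smooth_v (a b : Rbar) : smooth (strip a b) (fun _ v => v).
Proof.
  apply smooth_equiv. intros [|n].
  - intros u v _. split; trivial. apply continuity_2d_pt_id2.
  - apply (smooth_n_fun_v a b n (fun v => v) (fun _ => 1)).
    + intros v. apply (is_derive_id v).
    + apply smooth_n_const, strip_open.
Qed.

Lemma smooth_n_continuous_u (a b : Rbar) (f : R -> R) :
  (forall u, in_interval a b u -> ex_derive f u) ->
  smooth_n (strip a b) 0 (fun u _ => f u).
Proof.
  intros Hf u v H. split; trivial.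
  apply (continuity_1d_2d_pt_comp f (fun u _ => u)); [|apply continuity_2d_pt_id1].
  apply derivable_continuous_pt, ex_derive_Reals_0. now apply Hf.
Qed.

Lemma smooth_n_continuous_v (a b : Rbar) (f : R -> R) :
  (forall v, ex_derive f v) -> smooth_n (strip a b) 0 (fun _ v => f v).
Proof.
  intros Hf u v H. split; trivial.
  apply (continuity_1d_2d_pt_comp f (fun _ v => v)); [|apply continuity_2d_pt_id2].
  apply derivable_continuous_pt, ex_derive_Reals_0, Hf.
Qed.

(** The common form of both second-order equations, with k = gamma^2 or k = beta^2. *)
Definition profile_ode (k : R) (a b : Rbar) (f : R -> R) : Prop :=
  forall u, in_interval a b u ->
    ex_derive f u /\ is_derive (Derive f) u (k * (sinh (f u) * cosh (f u))).

(** Bootstrapping: cosh f, sinh f and f' form a system closed under differentiation, with polynomial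
    right-hand sides, so regularity of order n of all three gives order n + 1. *)
Lemma smooth_profile (k : R) (a b : Rbar) (f : R -> R) :
  profile_ode k a b f ->
  smooth (strip a b) (fun u _ => cosh (f u)) /\
  smooth (strip a b) (fun u _ => sinh (f u)) /\
  smooth (strip a b) (fun u _ => Derive f u).
Proof.
  intros Hf.
  assert (Hc : forall u, in_interval a b u ->
            is_derive (fun s => cosh (f s)) u (Derive f u * sinh (f u))).
  { intros u Hu. destruct (Hf u Hu). auto_derive; trivial.
    change (1 * Derive f u * sinh (f u) = Derive f u * sinh (f u)). ring. }
  assert (Hs : forall u, in_interval a b u ->
            is_derive (fun s => sinh (f s)) u (Derive f u * cosh (f u))).
  { intros u Hu. destruct (Hf u Hu). auto_derive; trivial.
    change (1 * Derive f u * cosh (f u) = Derive f u * cosh (f u)). ring. }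
  assert (HD : open_domain (strip a b)) by apply strip_open.
  enough (H : forall n, smooth_n (strip a b) n (fun u _ => cosh (f u)) /\
    smooth_n (strip a b) n (fun u _ => sinh (f u)) /\
    smooth_n (strip a b) n (fun u _ => Derive f u)).
  { rewrite !smooth_equiv. repeat split; apply H. }
  induction n as [|n [IC [IS IP]]].
  - split; [|split]; apply smooth_n_continuous_u; intros u Hu; eexists;
      [now apply Hc|now apply Hs|now apply Hf].
  - split; [|split].
    + apply (smooth_n_fun_u a b n _ _ Hc). now apply (smooth_n_mult _ n).
    + apply (smooth_n_fun_u a b n _ _ Hs). now apply (smooth_n_mult _ n).
    + apply (smooth_n_fun_u a b n _ (fun u => k * (sinh (f u) * cosh (f u)))).
      * intros u Hu. now apply Hf.
      * apply (smooth_n_mult _ n); trivial; [now apply smooth_n_const|].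
        now apply (smooth_n_mult _ n).
Qed.

(** Covers the hyperbolic pair of the catenoid (p = q = gamma) and the trigonometric pair of the
    helicoid (p = - beta, q = beta) by the same bootstrapping. *)
Lemma smooth_linear_pair (a b : Rbar) (p q : R) (f g : R -> R) :
  (forall v, is_derive f v (p * g v)) -> (forall v, is_derive g v (q * f v)) ->
  smooth (strip a b) (fun _ v => f v) /\ smooth (strip a b) (fun _ v => g v).
Proof.
  intros Hf Hg.
  enough (H : forall n, smooth_n (strip a b) n (fun _ v => f v) /\
    smooth_n (strip a b) n (fun _ v => g v)).
  { rewrite !smooth_equiv. split; apply H. }
  induction n as [|n [If Ig]].
  - split; apply smooth_n_continuous_v; intros v; eexists; auto.
  - split.
    + apply (smooth_n_fun_v a b n _ _ Hf), (smooth_n_mult _ n); trivial;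
        [|apply smooth_n_const]; apply strip_open.
    + apply (smooth_n_fun_v a b n _ _ Hg), (smooth_n_mult _ n); trivial;
        [|apply smooth_n_const]; apply strip_open.
Qed.

Lemma smooth_opp (D : Defs.domain) (f : R -> R -> R) :
  open_domain D -> smooth D f -> smooth D (fun u v => - f u v).
Proof.
  rewrite !smooth_equiv. intros HD Hf n.
  apply (smooth_n_ext D n (fun u v => (-1) * f u v)); trivial.
  - intros. ring.
  - apply smooth_n_mult; trivial. now apply smooth_n_const.
Qed.
(** * Data of the catenoid and of the helicoid *)

Lemma L3R_eq (p q : L3R) :
  x0 (fst p) = x0 (fst q) -> x1 (fst p) = x1 (fst q) -> x2 (fst p) = x2 (fst q) ->
  snd p = snd q -> p = q.
Proof. destruct p as [[] ?], q as [[] ?]; simpl. intros; subst; reflexivity. Qed.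

(* The common shape of the data of the catenoid: S is diagonal and traceless in the
   frame (d/du, d/dv), and T is a multiple of d/du. *)
Definition conformal_data (E k nu : R -> R) : data :=
  mkData (fun u _ X Y => E u * (fst X * fst Y + snd X * snd Y))
         (fun u _ X => (- k u * fst X, k u * snd X))
         (fun u _ => (/ E u, 0))
         (fun u _ => nu u).

Definition helicoid_normal (beta : R) (phi : R -> R) (u v : R) : L3R :=
  Defs.scal (/ Derive phi u)
    (mkL3 0 (sin (beta * v)) (- cos (beta * v)), beta * sinh (phi u)).

Lemma catenoid_partials (gamma : R) (chi : R -> R) (u v : R) :
  ex_derive chi u ->
  partial_u (catenoid gamma chi) u v =
    (mkL3 (Derive chi u * sinh (chi u) * cosh (gamma * v))
          (Derive chi u * cosh (chi u))
          (Derive chi u * sinh (chi u) * sinh (gamma * v)), 1) /\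
  partial_v (catenoid gamma chi) u v =
    (mkL3 (gamma * cosh (chi u) * sinh (gamma * v)) 0
          (gamma * cosh (chi u) * cosh (gamma * v)), 0).
Proof.
  intros H.
  split; apply L3R_eq; simpl; apply is_derive_unique; auto_derive; trivial;
    change (Derive (fun x => chi x) u) with (Derive chi u); ring.
Qed.

(** L is the u-derivative of the scalar factor - K of the normal. *)
Lemma catenoid_normal_partials (gamma : R) (chi : R -> R) (u v ddchi : R) :
  gamma <> 0 -> ex_derive chi u -> is_derive (Derive chi) u ddchi ->
  let K := / (gamma * cosh (chi u)) in
  let L := K ^ 2 * gamma * Derive chi u * sinh (chi u) in
  partial_u (catenoid_normal gamma chi) u v =
    (mkL3 ((L * sinh (chi u) - K * Derive chi u * cosh (chi u)) * cosh (gamma * v))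
          (L * cosh (chi u) - K * Derive chi u * sinh (chi u))
          ((L * sinh (chi u) - K * Derive chi u * cosh (chi u)) * sinh (gamma * v)),
     - L * Derive chi u + K * ddchi) /\
  partial_v (catenoid_normal gamma chi) u v =
    (mkL3 (- K * gamma * sinh (chi u) * sinh (gamma * v)) 0
          (- K * gamma * sinh (chi u) * cosh (gamma * v)), 0).
Proof.
  intros Hg H HP K L.
  assert (Hk : gamma * cosh (chi u) <> 0)
    by (apply Rmult_integral_contrapositive_currified; trivial;
        apply Rgt_not_eq, cosh_pos).
  assert (HP' : ex_derive (Derive chi) u) by (eexists; eassumption).
  unfold L, K. rewrite <- (is_derive_unique _ _ _ HP).
  split; apply L3R_eq; simpl; apply is_derive_unique; auto_derive;
    try (repeat split; assumption);
    try change (Derive (fun x => Derive chi x) u) with (Derive (Derive chi) u);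
    change (Derive (fun x => chi x) u) with (Derive chi u);
    field; split; trivial; apply Rgt_not_eq, cosh_pos.
Qed.

Lemma helicoid_partials (beta : R) (phi : R -> R) (u v : R) :
  ex_derive phi u ->
  partial_u (helicoid beta phi) u v =
    (mkL3 (Derive phi u * sinh (phi u))
          (Derive phi u * cosh (phi u) * cos (beta * v))
          (Derive phi u * cosh (phi u) * sin (beta * v)), 0) /\
  partial_v (helicoid beta phi) u v =
    (mkL3 0 (- (beta * sinh (phi u) * sin (beta * v)))
          (beta * sinh (phi u) * cos (beta * v)), 1).
Proof.
  intros H.
  split; apply L3R_eq; simpl; apply is_derive_unique; auto_derive; trivial;
    change (Derive (fun x => phi x) u) with (Derive phi u); ring.
Qed.

Lemma helicoid_normal_partials (beta : R) (phi : R -> R) (u v ddphi : R) :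
  Derive phi u <> 0 -> ex_derive phi u -> is_derive (Derive phi) u ddphi ->
  let W := / Derive phi u in
  partial_u (helicoid_normal beta phi) u v =
    (mkL3 0 (- W ^ 2 * ddphi * sin (beta * v)) (W ^ 2 * ddphi * cos (beta * v)),
     - W ^ 2 * ddphi * beta * sinh (phi u) + W * beta * Derive phi u * cosh (phi u)) /\
  partial_v (helicoid_normal beta phi) u v =
    (mkL3 0 (W * beta * cos (beta * v)) (W * beta * sin (beta * v)), 0).
Proof.
  intros H0 H HP W.
  assert (HP' : ex_derive (Derive phi) u) by (eexists; eassumption).
  unfold W. rewrite <- (is_derive_unique _ _ _ HP).
  split; apply L3R_eq; simpl; apply is_derive_unique; auto_derive;
    try (repeat split; assumption);
    try change (Derive (fun x => Derive phi x) u) with (Derive (Derive phi) u);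
    change (Derive (fun x => phi x) u) with (Derive phi u);
    field; trivial.
Qed.

(** The last conjunct turns the inverse into a polynomial relation: later the inverse is generalized
    to a variable K and the identities are left to [nsatz]. *)
Lemma catenoid_pointwise (gamma : R) (a b : Rbar) (chi : R -> R) (u : R) :
  gamma <> 0 -> catenoid_ode gamma a b chi -> in_interval a b u ->
  ex_derive chi u /\
  is_derive (Derive chi) u (gamma ^ 2 * cosh (chi u) * sinh (chi u)) /\
  1 + Derive chi u ^ 2 = gamma ^ 2 * cosh (chi u) ^ 2 /\
  / (gamma * cosh (chi u)) * (gamma * cosh (chi u)) = 1.
Proof.
  intros Hg [_ [_ H]] Hu. destruct (H u Hu) as [H1 [H2 [H3 _]]].
  repeat (split; trivial). apply Rinv_l.
  apply Rmult_integral_contrapositive_currified; trivial.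
  apply Rgt_not_eq, cosh_pos.
Qed.

Lemma catenoid_immersion (gamma : R) (a b : Rbar) (chi : R -> R) :
  gamma <> 0 -> catenoid_ode gamma a b chi ->
  conformal_immersion (strip a b) (catenoid gamma chi) /\
  direct_unit_normal (strip a b) (catenoid gamma chi) (catenoid_normal gamma chi).
Proof.
  intros Hg Hchi.
  assert (HD := strip_open a b).
  destruct (smooth_profile (gamma ^ 2) a b chi) as [SC [SS SP]].
  { intros u Hu. destruct (catenoid_pointwise gamma a b chi u) as [H1 [H2 _]]; trivial.
    split; trivial.
    replace (gamma ^ 2 * (sinh (chi u) * cosh (chi u)))
      with (gamma ^ 2 * cosh (chi u) * sinh (chi u)) by ring. exact H2. }
  destruct (smooth_linear_pair a b gamma gamma
    (fun v => cosh (gamma * v)) (fun v => sinh (gamma * v))) as [Sc Ss].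
  { intros v. auto_derive; trivial. ring. }
  { intros v. auto_derive; trivial. ring. }
  assert (SK : smooth (strip a b) (fun u _ => - / (gamma * cosh (chi u)))).
  { apply smooth_opp, smooth_inv; trivial.
    - intros u _ _. generalize (cosh_pos (chi u)). intros.
      apply Rmult_integral_contrapositive_currified; lra.
    - apply (smooth_mult _ (fun _ _ => gamma)); trivial. now apply smooth_const. }
  split; split.
  - repeat split; simpl.
    + now apply smooth_mult.
    + exact SS.
    + now apply smooth_mult.
    + apply smooth_u.
  - intros u v Hu.
    destruct (catenoid_pointwise gamma a b chi u) as [H1 [H2 [H3 H4]]]; trivial.
    destruct (catenoid_partials gamma chi u v H1) as [Pu Pv]. rewrite Pu, Pv.
    generalize (cosh_sqr (chi u)) (cosh_sqr (gamma * v)) (cosh_pos (chi u))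
      (cosh_pos (gamma * v)).
    intros Ec Es Pc Ps. split; [split|split; [|split]]; unfold inner, lor; simpl.
    + clear - Ec Es. pow_nsatz.
    + nra.
    + clear - Ec Es H3. pow_nsatz.
    + clear - Ec Es H3. pow_nsatz.
    + match goal with |- 0 < ?e => replace e with (1 + Derive chi u ^ 2) end.
      * generalize (pow2_ge_0 (Derive chi u)). lra.
      * clear - Ec Es. pow_nsatz.
  - repeat split; simpl; apply smooth_mult; trivial.
    + now apply smooth_mult.
    + now apply smooth_mult.
    + now apply smooth_opp.
  - intros u v Hu.
    destruct (catenoid_pointwise gamma a b chi u) as [H1 [H2 [H3 H4]]]; trivial.
    destruct (catenoid_partials gamma chi u v H1) as [Pu Pv]. rewrite Pu, Pv.
    generalize (cosh_sqr (chi u)) (cosh_sqr (gamma * v)). intros Ec Es.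
    unfold catenoid_normal, tangent_H2R, vol, det3, inner, lor; simpl.
    revert H4. generalize (/ (gamma * cosh (chi u))). intros K H4.
    split; [|split; [|split; [|split]]].
    + clear - Ec Es. pow_nsatz.
    + clear - Ec Es H3 H4. pow_nsatz.
    + clear - Ec Es H3 H4. pow_nsatz.
    + clear - Ec Es H3 H4. pow_nsatz.
    (* With a direct unit normal, the volume equals the conformal factor. *)
    + match goal with |- 0 < ?e => replace e with (1 + Derive chi u ^ 2) end.
      * generalize (pow2_ge_0 (Derive chi u)). lra.
      * clear - Ec Es H4. pow_nsatz.
Qed.

(** The coefficient k is read off the v-direction, where N_v = - k x_v with no correction from the
    projection. T points along d/du because the height of the catenoid is u. *)
Lemma catenoid_has_data (gamma : R) (a b : Rbar) (chi : R -> R) :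
  gamma <> 0 -> catenoid_ode gamma a b chi ->
  has_data (strip a b) (catenoid gamma chi) (catenoid_normal gamma chi)
    (conformal_data (fun u => (gamma * cosh (chi u)) ^ 2)
       (fun u => gamma * sinh (chi u) * (/ (gamma * cosh (chi u))) ^ 2)
       (fun u => Derive chi u * / (gamma * cosh (chi u)))).
Proof.
  intros Hg Hchi u v Hu.
  destruct (catenoid_pointwise gamma a b chi u) as [H1 [H2 [H3 H4]]]; trivial.
  destruct (catenoid_partials gamma chi u v H1) as [Pu Pv].
  destruct (catenoid_normal_partials gamma chi u v _ Hg H1 H2) as [Nu Nv].
  unfold nabla, Defs.differential. rewrite Pu, Pv, Nu, Nv.
  generalize (cosh_sqr (chi u)) (cosh_sqr (gamma * v)). intros Ec Es.
  unfold conformal_data, catenoid_normal, inner, lor; simpl.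
  replace (/ (gamma * cosh (chi u) * (gamma * cosh (chi u) * 1)))
    with (/ (gamma * cosh (chi u)) * / (gamma * cosh (chi u)))
    by (rewrite Rmult_1_r; symmetry; apply Rinv_mult).
  clear Hu Pu Pv Nu Nv.
  revert H4. generalize (/ (gamma * cosh (chi u))). intros K H4.
  split; [|split; [|split]].
  - intros [X1 X2] [Y1 Y2]; simpl. clear - Ec Es H3. pow_nsatz.
  - intros [X1 X2]; apply L3R_eq; simpl; unfold lor; simpl; clear - Ec Es H3 H4.
    + pow_nsatz.
    + pow_nsatz.
    + pow_nsatz.
    + pow_nsatz.
  - ring.
  - apply L3R_eq; simpl; clear - Ec Es H3 H4.
    + pow_nsatz.
    + pow_nsatz.
    + pow_nsatz.
    + pow_nsatz.
Qed.

Lemma helicoid_pointwise (beta : R) (a b : Rbar) (phi : R -> R) (u : R) :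
  helicoid_ode beta a b phi -> in_interval a b u ->
  ex_derive phi u /\
  is_derive (Derive phi) u (beta ^ 2 * sinh (phi u) * cosh (phi u)) /\
  Derive phi u ^ 2 = 1 + beta ^ 2 * sinh (phi u) ^ 2 /\
  0 < Derive phi u /\
  / Derive phi u * Derive phi u = 1.
Proof.
  intros [_ [_ H]] Hu. destruct (H u Hu) as [H1 [H2 [H3 H4]]].
  repeat (split; trivial). apply Rinv_l. lra.
Qed.

Lemma cos_sqr (x : R) : cos x ^ 2 = 1 - sin x ^ 2.
Proof. generalize (sin2_cos2 x). unfold Rsqr. simpl. lra. Qed.

Lemma helicoid_immersion (beta : R) (a b : Rbar) (phi : R -> R) :
  helicoid_ode beta a b phi ->
  conformal_immersion (strip a b) (helicoid beta phi) /\
  direct_unit_normal (strip a b) (helicoid beta phi) (helicoid_normal beta phi).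
Proof.
  intros Hphi.
  assert (HD := strip_open a b).
  destruct (smooth_profile (beta ^ 2) a b phi) as [SC [SS SP]].
  { intros u Hu. destruct (helicoid_pointwise beta a b phi u) as [H1 [H2 _]]; trivial.
    split; trivial. rewrite <- Rmult_assoc. exact H2. }
  destruct (smooth_linear_pair a b (- beta) beta
    (fun v => cos (beta * v)) (fun v => sin (beta * v))) as [Sc Ss].
  { intros v. auto_derive; trivial. ring. }
  { intros v. auto_derive; trivial. ring. }
  assert (SW : smooth (strip a b) (fun u _ => / Derive phi u)).
  { apply smooth_inv; trivial. intros u v Hu.
    destruct (helicoid_pointwise beta a b phi u) as [_ [_ [_ [H _]]]]; trivial. lra. }
  split; split.
  - repeat split; simpl.
    + exact SC.
    + now apply smooth_mult.
    + now apply smooth_mult.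
    + apply smooth_v.
  - intros u v Hu.
    destruct (helicoid_pointwise beta a b phi u) as [H1 [H2 [H3 [H4 H5]]]]; trivial.
    destruct (helicoid_partials beta phi u v H1) as [Pu Pv]. rewrite Pu, Pv.
    generalize (cosh_sqr (phi u)) (cos_sqr (beta * v)). intros Ec Es.
    split; [split|split; [|split]]; unfold inner, lor; simpl.
    + clear - Ec Es. pow_nsatz.
    + apply cosh_pos.
    + clear - Ec Es H3. pow_nsatz.
    + ring.
    + match goal with |- 0 < ?e => replace e with (Derive phi u * Derive phi u) end.
      * now apply Rmult_lt_0_compat.
      * clear - Ec Es. pow_nsatz.
  - repeat split; simpl; apply smooth_mult; trivial.
    + now apply smooth_const.
    + now apply smooth_opp.
    + apply (smooth_mult _ (fun _ _ => beta)); trivial. now apply smooth_const.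
  - intros u v Hu.
    destruct (helicoid_pointwise beta a b phi u) as [H1 [H2 [H3 [H4 H5]]]]; trivial.
    destruct (helicoid_partials beta phi u v H1) as [Pu Pv]. rewrite Pu, Pv.
    generalize (cosh_sqr (phi u)) (cos_sqr (beta * v)). intros Ec Es.
    unfold helicoid_normal, tangent_H2R, vol, det3, inner, lor; simpl.
    clear - Ec Es H3 H4 H5.
    revert H5. generalize (/ Derive phi u). intros W H5.
    split; [|split; [|split; [|split]]].
    + ring.
    + clear H4. pow_nsatz.
    + ring.
    + clear H4. pow_nsatz.
    + match goal with |- 0 < ?e => replace e with (Derive phi u * Derive phi u) end.
      * now apply Rmult_lt_0_compat.
      * clear H4. pow_nsatz.
Qed.

(** The height is now v, so T points along d/dv, and the shape operator exchanges the two coordinate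
    directions up to the factor - k. This is J applied to data of the catenoid's diagonal shape. *)
Lemma helicoid_has_data (beta : R) (a b : Rbar) (phi : R -> R) :
  helicoid_ode beta a b phi ->
  has_data (strip a b) (helicoid beta phi) (helicoid_normal beta phi)
    (conjugate_data
       (conformal_data (fun u => Derive phi u ^ 2)
         (fun u => beta * cosh (phi u) * (/ Derive phi u) ^ 2)
         (fun u => beta * sinh (phi u) * / Derive phi u))).
Proof.
  intros Hphi u v Hu.
  destruct (helicoid_pointwise beta a b phi u) as [H1 [H2 [H3 [H4 H5]]]]; trivial.
  destruct (helicoid_partials beta phi u v H1) as [Pu Pv].
  destruct (helicoid_normal_partials beta phi u v (beta ^ 2 * sinh (phi u) * cosh (phi u)))
    as [Nu Nv]; trivial; [lra|].
  unfold nabla, Defs.differential. rewrite Pu, Pv, Nu, Nv.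
  generalize (cosh_sqr (phi u)) (cos_sqr (beta * v)). intros Ec Es.
  unfold conformal_data, helicoid_normal, inner, lor; simpl.
  replace (/ (Derive phi u * (Derive phi u * 1)))
    with (/ Derive phi u * / Derive phi u)
    by (rewrite Rmult_1_r; symmetry; apply Rinv_mult).
  clear Hu Pu Pv Nu Nv.
  revert H5. generalize (/ Derive phi u). intros W H5.
  split; [|split; [|split]].
  - intros [X1 X2] [Y1 Y2]; simpl. clear - Ec Es H3. pow_nsatz.
  - intros [X1 X2]; apply L3R_eq; simpl; unfold lor; simpl; clear - Ec Es H3 H5.
    + pow_nsatz.
    + pow_nsatz.
    + pow_nsatz.
    + pow_nsatz.
  - ring.
  - apply L3R_eq; simpl; clear - Ec Es H3 H5.
    + pow_nsatz.
    + pow_nsatz.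
    + pow_nsatz.
    + pow_nsatz.
Qed.

Lemma has_data_conformal_ext (a b : Rbar) (x N : R -> R -> L3R)
    (E E' k k' nu nu' : R -> R) :
  (forall u, in_interval a b u -> E u = E' u /\ k u = k' u /\ nu u = nu' u) ->
  has_data (strip a b) x N (conformal_data E k nu) ->
  has_data (strip a b) x N (conformal_data E' k' nu').
Proof.
  intros H Hd u v Hu. destruct (H u Hu) as [H1 [H2 H3]].
  specialize (Hd u v Hu). simpl in *. now rewrite <- H1, <- H2, <- H3.
Qed.

Lemma conformal_minimal_catenoid (gamma : R) (a b : Rbar) (chi : R -> R) :
  gamma <> 0 -> catenoid_ode gamma a b chi ->
  conformal_minimal_immersion (strip a b) (catenoid gamma chi) (catenoid_normal gamma chi).
Proof.
  intros Hg Hchi. destruct (catenoid_immersion gamma a b chi) as [H1 H2]; trivial.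
  split; [|split]; trivial. eexists. split; [now apply catenoid_has_data|].
  intros u v _. unfold trace; simpl. ring.
Qed.

Lemma conformal_minimal_helicoid (beta : R) (a b : Rbar) (phi : R -> R) :
  helicoid_ode beta a b phi ->
  conformal_minimal_immersion (strip a b) (helicoid beta phi) (helicoid_normal beta phi).
Proof.
  intros Hphi. destruct (helicoid_immersion beta a b phi) as [H1 H2]; trivial.
  split; [|split]; trivial. eexists. split; [now apply helicoid_has_data|].
  intros u v _. unfold trace; simpl. ring.
Qed.

(** * Orthonormal frames of L^3 *)

Lemma L3_eq (p q : L3) : x0 p = x0 q -> x1 p = x1 q -> x2 p = x2 q -> p = q.
Proof. destruct p, q; simpl; intros; subst; reflexivity. Qed.

Definition orthonormal_frame (p e f : L3) : Prop :=
  lor p p = -1 /\ lor e e = 1 /\ lor f f = 1 /\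
  lor p e = 0 /\ lor p f = 0 /\ lor e f = 0 /\ det3 p e f = 1.

(** Cramer's rule: the determinant times a coordinate of z is a combination of the three
    products. *)
Lemma orthogonal_to_frame_0 (p e f z : L3) :
  det3 p e f <> 0 -> lor z p = 0 -> lor z e = 0 -> lor z f = 0 -> z = mkL3 0 0 0.
Proof.
  destruct p as [p0 p1 p2], e as [e0 e1 e2], f as [f0 f1 f2], z as [z0 z1 z2].
  unfold det3, lor; simpl. intros Hd Hp He Hf.
  apply L3_eq; simpl; (apply Rmult_eq_reg_l with (2 := Hd); rewrite Rmult_0_r);
    clear Hd; nsatz.
Qed.

Lemma frame_expansion (p e f z : L3) :
  orthonormal_frame p e f ->
  z = L3_add (L3_scal (- lor z p) p) (L3_add (L3_scal (lor z e) e) (L3_scal (lor z f) f)).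
Proof.
  intros [Hp [He [Hf [Hpe [Hpf [Hef Hd]]]]]].
  (* [w] is the opposite of the expected expansion; z + w is shown orthogonal to the frame. *)
  set (w := L3_add (L3_scal (lor z p) p)
              (L3_add (L3_scal (- lor z e) e) (L3_scal (- lor z f) f))).
  assert (Hz : L3_add z w = mkL3 0 0 0).
  { apply (orthogonal_to_frame_0 p e f).
    - rewrite Hd. lra.
    - transitivity (lor z p + lor z p * lor p p - lor z e * lor p e - lor z f * lor p f).
      + unfold w, lor, L3_add, L3_scal; simpl; ring.
      + rewrite Hp, Hpe, Hpf. ring.
    - transitivity (lor z e + lor z p * lor p e - lor z e * lor e e - lor z f * lor e f).
      + unfold w, lor, L3_add, L3_scal; simpl; ring.
      + rewrite Hpe, He, Hef. ring.
    - transitivity (lor z f + lor z p * lor p f - lor z e * lor e f - lor z f * lor f f).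
      + unfold w, lor, L3_add, L3_scal; simpl; ring.
      + rewrite Hpf, Hef, Hf. ring. }
  assert (Z0 := f_equal x0 Hz). assert (Z1 := f_equal x1 Hz). assert (Z2 := f_equal x2 Hz).
  unfold w in *. simpl in *. apply L3_eq; simpl; lra.
Qed.

(** The x0 coordinate is opposite to the Euclidean one, so that [lor_cross] holds for the Lorentz
    form. *)
Definition cross (p q : L3) : L3 :=
  mkL3 (x2 p * x1 q - x1 p * x2 q)
       (x2 p * x0 q - x0 p * x2 q)
       (x0 p * x1 q - x1 p * x0 q).

Lemma lor_cross (p q r : L3) : lor (cross p q) r = det3 p q r.
Proof. unfold lor, cross, det3; simpl; ring. Qed.

(** By [lor_cross], the coefficients of a cross product in the frame are determinants of frame
    vectors. The first identity is what makes e differentiable through f and p. *)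
Lemma frame_cross (p e f : L3) :
  orthonormal_frame p e f ->
  cross f p = e /\ cross f e = p /\ cross e p = L3_scal (-1) f.
Proof.
  intros H. pose proof H as [_ [_ [_ [_ [_ [_ Hd]]]]]].
  assert (D1 : forall a b, det3 a b a = 0) by (intros; unfold det3; ring).
  assert (D2 : forall a b, det3 a b b = 0) by (intros; unfold det3; ring).
  assert (D3 : det3 f p e = 1) by (rewrite <- Hd; unfold det3; ring).
  assert (D4 : det3 f e p = -1)
    by (transitivity (- det3 p e f); [unfold det3; ring|lra]).
  assert (D5 : det3 e p f = -1)
    by (transitivity (- det3 p e f); [unfold det3; ring|lra]).
  split; [|split]; (etransitivity; [apply (frame_expansion p e f _ H)|]);
    rewrite !lor_cross, ?D1, ?D2, ?D3, ?D4, ?D5; apply L3_eq; simpl; ring.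
Qed.

(** Reversed Cauchy-Schwarz: (p1 q1 + p2 q2)^2 <= (p0^2 - 1) (q0^2 - 1) < (p0 q0)^2. *)
Lemma H2_lor_neg (p q : L3) : H2 p -> H2 q -> lor p q < 0.
Proof.
  destruct p as [p0 p1 p2], q as [q0 q1 q2]. unfold H2, lor; simpl.
  intros [Hp Pp] [Hq Pq].
  apply Rnot_le_lt. intros H.
  assert (P : 0 < p0 * q0) by nra.
  assert (A : (p0 * q0) ^ 2 <= (p1 * q1 + p2 * q2) ^ 2) by (apply pow_incr; lra).
  assert (B : (p1 * q1 + p2 * q2) ^ 2 <= (p1 * p1 + p2 * p2) * (q1 * q1 + q2 * q2))
    by (generalize (pow2_ge_0 (p1 * q2 - p2 * q1)); intros; nra).
  replace (p1 * p1 + p2 * p2) with (p0 * p0 - 1) in B by lra.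
  replace (q1 * q1 + q2 * q2) with (q0 * q0 - 1) in B by lra.
  nra.
Qed.

Lemma frame_coordinates_isometry (p e f : L3) :
  orthonormal_frame p e f -> 0 < x0 p ->
  direct_isometry_H2 (fun w => mkL3 (- lor w p) (lor w e) (lor w f)).
Proof.
  intros H Hp0. pose proof H as [Hp [_ [_ [_ [_ [_ Hd]]]]]].
  assert (Hlor : forall w z, - (- lor w p * - lor z p) + lor w e * lor z e
                   + lor w f * lor z f = lor w z).
  { intros w z. rewrite (frame_expansion p e f z H) at 4.
    unfold lor, L3_add, L3_scal; simpl; ring. }
  split; [|split].
  - intros w Hw. split.
    + unfold lor at 1; simpl. rewrite Hlor. apply Hw.
    + simpl. assert (lor w p < 0) by (apply H2_lor_neg; trivial; split; trivial). lra.
  - intros w z _ _. unfold lor at 1; simpl. apply Hlor.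
  - intros w z t _ _ _.
    (* Multiplicativity of the determinant; the sign of the Lorentz form and that of the timelike
       coordinate cancel. *)
    transitivity (det3 w z t * det3 p e f); [|rewrite Hd; ring].
    unfold det3, lor; simpl; ring.
Qed.

(** * Rigidity *)

Lemma strip_const (a b : Rbar) (g : R -> R -> R) (u v : R) :
  in_interval a b 0 -> in_interval a b u ->
  (forall s t : R, in_interval a b s -> is_derive (fun r : R => g r t) s 0) ->
  (forall s t : R, in_interval a b s -> is_derive (fun r : R => g s r) t 0) ->
  g u v = g 0 0.
Proof.
  intros H0 Hu Hgu Hgv. transitivity (g 0 v).
  - apply (is_derive_zero_const a b (fun r : R => g r v) 0 u); auto.
  - apply (is_derive_zero_const m_infty p_infty (fun r : R => g 0 r) 0 v); auto; now split.
Qed.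

(** Serves both directions: for v-derivatives, [Pu], [Eu], [Fu] are instantiated with the
    v-equations. *)
Ltac unfold_derivatives phi Hode Pu Eu Fu s t Hs :=
  destruct (helicoid_pointwise _ _ _ _ s Hode Hs) as [Hphi _];
  generalize (cosh_sqr (phi s)); intros Ec;
  auto_derive;
  [ repeat match goal with |- _ /\ _ => split end;
    first [ exact I | exact Hphi | eexists; exact (Pu s t Hs)
          | eexists; exact (Eu s t Hs) | eexists; exact (Fu s t Hs) ]
  | change (Derive (fun x => phi x) s) with (Derive phi s);
    rewrite ?(is_derive_unique _ _ _ (Pu s t Hs)), ?(is_derive_unique _ _ _ (Eu s t Hs)),
      ?(is_derive_unique _ _ _ (Fu s t Hs)) ].

(* One coordinate of the moving frame.  The left-hand sides are the columns of the
   frame multiplied by the inverse of the helicoid's frame. *)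
Lemma moving_frame_const (beta : R) (a b : Rbar) (phi : R -> R)
    (p e f : R -> R -> R) (u v : R) :
  helicoid_ode beta a b phi ->
  (forall s t : R, in_interval a b s -> is_derive (fun r : R => p r t) s (Derive phi s * e s t)) ->
  (forall s t : R, in_interval a b s ->
     is_derive (fun r : R => p s r) t (beta * sinh (phi s) * f s t)) ->
  (forall s t : R, in_interval a b s -> is_derive (fun r : R => e r t) s (Derive phi s * p s t)) ->
  (forall s t : R, in_interval a b s ->
     is_derive (fun r : R => e s r) t (beta * cosh (phi s) * f s t)) ->
  (forall s t : R, in_interval a b s -> is_derive (fun r : R => f r t) s 0) ->
  (forall s t : R, in_interval a b s ->
     is_derive (fun r : R => f s r) t
       (beta * sinh (phi s) * p s t + - (beta * cosh (phi s)) * e s t)) ->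
  in_interval a b u ->
  cosh (phi u) * p u v - sinh (phi u) * e u v = p 0 0 /\
  cos (beta * v) * (cosh (phi u) * e u v - sinh (phi u) * p u v)
    - sin (beta * v) * f u v = e 0 0 /\
  sin (beta * v) * (cosh (phi u) * e u v - sinh (phi u) * p u v)
    + cos (beta * v) * f u v = f 0 0.
Proof.
  intros Hode Pu Pv Eu Ev Fu Fv Hu.
  pose proof Hode as [H0 [Hphi0 _]].
  assert (C0 : cosh (phi 0) = 1) by (rewrite Hphi0; apply cosh_0).
  assert (S0 : sinh (phi 0) = 0) by (rewrite Hphi0; apply sinh_0).
  assert (c0 : cos (beta * 0) = 1) by (rewrite Rmult_0_r; apply cos_0).
  assert (s0 : sin (beta * 0) = 0) by (rewrite Rmult_0_r; apply sin_0).
  split; [|split].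
  - rewrite (strip_const a b
      (fun u v => cosh (phi u) * p u v - sinh (phi u) * e u v) u v); trivial.
    + rewrite C0, S0. ring.
    + intros s t Hs. unfold_derivatives phi Hode Pu Eu Fu s t Hs. ring.
    + intros s t Hs. unfold_derivatives phi Hode Pv Ev Fv s t Hs. ring.
  - rewrite (strip_const a b (fun u v =>
      cos (beta * v) * (cosh (phi u) * e u v - sinh (phi u) * p u v)
        - sin (beta * v) * f u v) u v); trivial.
    + rewrite C0, S0, c0, s0. ring.
    + intros s t Hs. unfold_derivatives phi Hode Pu Eu Fu s t Hs. ring.
    + intros s t Hs. unfold_derivatives phi Hode Pv Ev Fv s t Hs.
      clear - Ec. pow_nsatz.
  - rewrite (strip_const a b (fun u v =>
      sin (beta * v) * (cosh (phi u) * e u v - sinh (phi u) * p u v)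
        + cos (beta * v) * f u v) u v); trivial.
    + rewrite C0, S0, c0, s0. ring.
    + intros s t Hs. unfold_derivatives phi Hode Pu Eu Fu s t Hs. ring.
    + intros s t Hs. unfold_derivatives phi Hode Pv Ev Fv s t Hs.
      clear - Ec. pow_nsatz.
Qed.

Definition is_derive_L3 (c : R -> L3) (s : R) (w : L3) : Prop :=
  is_derive (fun r : R => x0 (c r)) s (x0 w) /\
  is_derive (fun r : R => x1 (c r)) s (x1 w) /\
  is_derive (fun r : R => x2 (c r)) s (x2 w).

Lemma moving_frame_const_L3 (beta : R) (a b : Rbar) (phi : R -> R)
    (p e f : R -> R -> L3) (u v : R) :
  helicoid_ode beta a b phi ->
  (forall s t, in_interval a b s ->
     is_derive_L3 (fun r => p r t) s (L3_scal (Derive phi s) (e s t))) ->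
  (forall s t, in_interval a b s ->
     is_derive_L3 (fun r => p s r) t (L3_scal (beta * sinh (phi s)) (f s t))) ->
  (forall s t, in_interval a b s ->
     is_derive_L3 (fun r => e r t) s (L3_scal (Derive phi s) (p s t))) ->
  (forall s t, in_interval a b s ->
     is_derive_L3 (fun r => e s r) t (L3_scal (beta * cosh (phi s)) (f s t))) ->
  (forall s t, in_interval a b s -> is_derive_L3 (fun r => f r t) s (mkL3 0 0 0)) ->
  (forall s t, in_interval a b s ->
     is_derive_L3 (fun r => f s r) t
       (L3_add (L3_scal (beta * sinh (phi s)) (p s t))
               (L3_scal (- (beta * cosh (phi s))) (e s t)))) ->
  in_interval a b u ->
  let q := L3_add (L3_scal (cosh (phi u)) (e u v)) (L3_scal (- sinh (phi u)) (p u v)) in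
  L3_add (L3_scal (cosh (phi u)) (p u v)) (L3_scal (- sinh (phi u)) (e u v)) = p 0 0 /\
  L3_add (L3_scal (cos (beta * v)) q) (L3_scal (- sin (beta * v)) (f u v)) = e 0 0 /\
  L3_add (L3_scal (sin (beta * v)) q) (L3_scal (cos (beta * v)) (f u v)) = f 0 0.
Proof.
  intros Hode Pu Pv Eu Ev Fu Fv Hu q.
  destruct (moving_frame_const beta a b phi (fun s t => x0 (p s t))
    (fun s t => x0 (e s t)) (fun s t => x0 (f s t)) u v Hode
    (fun s t Hs => proj1 (Pu s t Hs))
    (fun s t Hs => proj1 (Pv s t Hs))
    (fun s t Hs => proj1 (Eu s t Hs))
    (fun s t Hs => proj1 (Ev s t Hs))
    (fun s t Hs => proj1 (Fu s t Hs))
    (fun s t Hs => proj1 (Fv s t Hs))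
    Hu) as [A0 [B0 C0]].
  destruct (moving_frame_const beta a b phi (fun s t => x1 (p s t))
    (fun s t => x1 (e s t)) (fun s t => x1 (f s t)) u v Hode
    (fun s t Hs => proj1 (proj2 (Pu s t Hs)))
    (fun s t Hs => proj1 (proj2 (Pv s t Hs)))
    (fun s t Hs => proj1 (proj2 (Eu s t Hs)))
    (fun s t Hs => proj1 (proj2 (Ev s t Hs)))
    (fun s t Hs => proj1 (proj2 (Fu s t Hs)))
    (fun s t Hs => proj1 (proj2 (Fv s t Hs)))
    Hu) as [A1 [B1 C1]].
  destruct (moving_frame_const beta a b phi (fun s t => x2 (p s t))
    (fun s t => x2 (e s t)) (fun s t => x2 (f s t)) u v Hode
    (fun s t Hs => proj2 (proj2 (Pu s t Hs)))
    (fun s t Hs => proj2 (proj2 (Pv s t Hs)))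
    (fun s t Hs => proj2 (proj2 (Eu s t Hs)))
    (fun s t Hs => proj2 (proj2 (Ev s t Hs)))
    (fun s t Hs => proj2 (proj2 (Fu s t Hs)))
    (fun s t Hs => proj2 (proj2 (Fv s t Hs)))
    Hu) as [A2 [B2 C2]].
  unfold q. split; [|split]; apply L3_eq; simpl;
    rewrite <- ?A0, <- ?A1, <- ?A2, <- ?B0, <- ?B1, <- ?B2, <- ?C0, <- ?C1, <- ?C2; ring.
Qed.

Lemma lor_sym (p q : L3) : lor p q = lor q p.
Proof. unfold lor; ring. Qed.

Lemma lor_scal_l (k : R) (p q : L3) : lor (L3_scal k p) q = k * lor p q.
Proof. unfold lor, L3_scal; simpl; ring. Qed.

Lemma lor_scal_r (k : R) (p q : L3) : lor p (L3_scal k q) = k * lor p q.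
Proof. unfold lor, L3_scal; simpl; ring. Qed.

(** Gram determinant, with the sign - 1 of the determinant of the Lorentz form. *)
Lemma det3_sqr_gram (p e f : L3) :
  det3 p e f ^ 2 =
  - (lor p p * (lor e e * lor f f - lor e f ^ 2)
     - lor p e * (lor p e * lor f f - lor e f * lor p f)
     + lor p f * (lor p e * lor e f - lor e e * lor p f)).
Proof. unfold det3, lor; ring. Qed.

(* P = phi', Q = 1 / P, A = beta cosh phi, B = beta sinh phi; m is the unit normal, and
   the last three hypotheses are the equations for T, S (d/du) and S (d/dv). *)
Lemma adapted_frame (y yu yv m mu mv : L3R) (P Q A B : R) :
  let p := fst y in
  let e := L3_scal Q (fst yu) in
  let f := L3_scal (- P) (fst m) in
  let k := A * Q ^ 2 in
  Q * P = 1 -> P ^ 2 = 1 + B ^ 2 ->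
  lor p p = -1 -> lor p (fst yu) = 0 -> lor p (fst m) = 0 ->
  lor (fst yu) (fst m) + lor p (fst mu) = 0 ->
  lor (fst yv) (fst m) + lor p (fst mv) = 0 ->
  inner yu yu = P ^ 2 -> inner yu yv = 0 ->
  inner m m = 1 -> inner m yu = 0 -> 0 < vol y yu yv m -> snd m = B * Q ->
  add (Defs.scal (- 0) yu) (Defs.scal (Q ^ 2) yv) = add dt (Defs.scal (- (B * Q)) m) ->
  add (Defs.scal (- (k * 0)) yu) (Defs.scal (- k * 1) yv)
    = Defs.scal (-1) (proj_H2R y (add (Defs.scal 1 mu) (Defs.scal 0 mv))) ->
  add (Defs.scal (- (k * 1)) yu) (Defs.scal (- k * 0) yv)
    = Defs.scal (-1) (proj_H2R y (add (Defs.scal 0 mu) (Defs.scal 1 mv))) ->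
  orthonormal_frame p e f /\ snd yu = 0 /\ snd yv = 1 /\
  fst yu = L3_scal P e /\ fst yv = L3_scal B f /\
  fst mu = L3_scal (k * B) f /\
  fst mv = L3_add (L3_scal (k * P) e) (L3_scal (- (B * Q)) p).
Proof.
  destruct y as [p y3], yu as [pu tu], yv as [pv tv], m as [h n], mu as [hu nu'],
    mv as [hv nv].
  intros p' e f k. subst p'. unfold inner. cbn [fst snd] in e, f |- *.
  intros HQ HP Hpp Hppu Hph Hu Hv Euu Euv Emm Emu Hvol Hn HT HS1 HS2.
  (* The equation for T reads Q^2 yv = dt - B Q m; multiplied by P^2, its L^3 part gives [pv] and
     its R part gives tv = P^2 - B^2 = 1. *)
  assert (Epv : pv = L3_scal (- (P * B)) h).
  { assert (T0 := f_equal (fun q => P ^ 2 * x0 (fst q)) HT).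
    assert (T1 := f_equal (fun q => P ^ 2 * x1 (fst q)) HT).
    assert (T2 := f_equal (fun q => P ^ 2 * x2 (fst q)) HT).
    simpl in T0, T1, T2. clear - HQ T0 T1 T2. apply L3_eq; simpl; nsatz. }
  assert (Htv : tv = 1).
  { assert (T := f_equal (fun q => P ^ 2 * snd q) HT). simpl in T.
    clear - HQ HP Hn T. pow_nsatz. }
  rewrite Epv in Euv, Hv. rewrite lor_scal_r in Euv. rewrite lor_scal_l in Hv.
  rewrite (lor_sym h pu) in Emu.
  (* Orthogonality of [yu] to both [yv] and [m] gives (1 + B^2) tu = 0. *)
  assert (Htu : tu = 0).
  { clear - HQ HP Hn Euv Emu Htv. revert Euv Emu. generalize (lor pu h).
    intros. pow_nsatz. }
  subst tv tu n.
  assert (Euh : lor pu h = 0) by lra.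
  assert (Ehh : lor h h = Q ^ 2) by (clear - HQ HP Emm; revert Emm; generalize (lor h h);
    intros; pow_nsatz).
  assert (Euu' : lor pu pu = P ^ 2) by lra.
  assert (Fee : lor e e = 1) by (unfold e; rewrite lor_scal_l, lor_scal_r, Euu';
    clear - HQ; pow_nsatz).
  assert (Fff : lor f f = 1) by (unfold f; rewrite lor_scal_l, lor_scal_r, Ehh;
    clear - HQ; pow_nsatz).
  assert (Fpe : lor p e = 0) by (unfold e; rewrite lor_scal_r, Hppu; ring).
  assert (Fpf : lor p f = 0) by (unfold f; rewrite lor_scal_r, Hph; ring).
  assert (Fef : lor e f = 0)
    by (unfold e, f; rewrite lor_scal_l, lor_scal_r, Euh; ring).
  assert (Hhf : h = L3_scal (- Q) f)
    by (unfold f; clear - HQ; apply L3_eq; simpl; nsatz).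
  assert (Hue : pu = L3_scal P e)
    by (unfold e; clear - HQ; apply L3_eq; simpl; nsatz).
  assert (Hvf : pv = L3_scal B f)
    by (rewrite Epv; unfold f; apply L3_eq; simpl; ring).
  (* Orthonormality gives det3 = 1 or -1; the volume equals P^2 det3, so its positivity decides. *)
  assert (Hdet : det3 p e f = 1).
  { assert (D2 : det3 p e f ^ 2 = 1)
      by (rewrite det3_sqr_gram, Hpp, Fee, Fff, Fpe, Fpf, Fef; ring).
    assert (V : vol (p, y3) (pu, 0) (pv, 1) (h, B * Q) = P ^ 2 * det3 p e f).
    { rewrite HP, Hvf, Hue. transitivity (Q * P * (1 + B ^ 2) * det3 p e f).
      - rewrite Hhf. unfold vol, det3, L3_scal; simpl; ring.
      - rewrite HQ. ring. }
    rewrite V, HP in Hvol. generalize (pow2_ge_0 B). intros.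
    assert (0 < det3 p e f) by nra. nra. }
  split; [now repeat split|]. repeat (split; trivial).
  (* No projection term here: differentiating the tangency of m gives lor p hu = - lor pu h = 0. *)
  - assert (L : lor p (L3_add (L3_scal 1 hu) (L3_scal 0 hv)) = 0).
    { transitivity (lor p hu); [unfold lor, L3_add, L3_scal; simpl; ring|lra]. }
    assert (S0 := f_equal (fun q => x0 (fst q)) HS1).
    assert (S1 := f_equal (fun q => x1 (fst q)) HS1).
    assert (S2 := f_equal (fun q => x2 (fst q)) HS1).
    clear HS1. unfold proj_H2R in S0, S1, S2. simpl in S0, S1, S2.
    rewrite L in S0, S1, S2.
    transitivity (L3_scal k pv); [apply L3_eq; simpl; lra|].
    rewrite Hvf. apply L3_eq; simpl; ring.
  (* Here lor p hv = - lor pv h = P B Q^2 = B Q, which produces the component along p. *)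
  - assert (L : lor p (L3_add (L3_scal 0 hu) (L3_scal 1 hv)) = B * Q).
    { transitivity (lor p hv); [unfold lor, L3_add, L3_scal; simpl; ring|].
      rewrite Ehh in Hv. clear - Hv HQ. revert Hv. generalize (lor p hv).
      intros; pow_nsatz. }
    assert (S0 := f_equal (fun q => x0 (fst q)) HS2).
    assert (S1 := f_equal (fun q => x1 (fst q)) HS2).
    assert (S2 := f_equal (fun q => x2 (fst q)) HS2).
    clear HS2. unfold proj_H2R in S0, S1, S2. simpl in S0, S1, S2.
    rewrite L in S0, S1, S2.
    transitivity (L3_add (L3_scal k pu) (L3_scal (- (B * Q)) p));
      [apply L3_eq; simpl; lra|].
    rewrite Hue. apply L3_eq; simpl; ring.
Qed.

(** Each coordinate of [cross] has this form, and [lor] is a sum of two such terms, one of them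
    padded with a zero product. *)
Lemma is_derive_minor (f g h k : R -> R) (s f' g' h' k' : R) :
  is_derive f s f' -> is_derive g s g' -> is_derive h s h' -> is_derive k s k' ->
  is_derive (fun r : R => f r * g r - h r * k r) s
    ((f' * g s - h' * k s) + (f s * g' - h s * k')).
Proof.
  intros Hf Hg Hh Hk. auto_derive.
  - repeat match goal with |- _ /\ _ => split end;
      first [exact I | eexists; eassumption].
  - change (1 * Derive f s * g s + f s * (1 * Derive g s)
      + - (1 * Derive h s * k s + h s * (1 * Derive k s))
      = f' * g s - h' * k s + (f s * g' - h s * k')).
    rewrite (is_derive_unique _ _ _ Hf), (is_derive_unique _ _ _ Hg),
      (is_derive_unique _ _ _ Hh), (is_derive_unique _ _ _ Hk). ring.
Qed.

Lemma is_derive_lor (c d : R -> L3) (s : R) (c' d' : L3) :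
  is_derive_L3 c s c' -> is_derive_L3 d s d' ->
  is_derive (fun r : R => lor (c r) (d r)) s (lor c' (d s) + lor (c s) d').
Proof.
  intros [C0 [C1 C2]] [D0 [D1 D2]].
  apply (is_derive_ext
    (fun r : R => (x1 (c r) * x1 (d r) - x0 (c r) * x0 (d r))
      + (x2 (c r) * x2 (d r) - 0 * 0))).
  - intros r. unfold lor. match goal with |- ?a = ?b => change (@eq R a b) end. ring.
  - assert (Z : is_derive (fun _ : R => 0) s 0) by apply (is_derive_const 0).
    replace (lor c' (d s) + lor (c s) d') with
      (((x1 c' * x1 (d s) - x0 c' * x0 (d s)) + (x1 (c s) * x1 d' - x0 (c s) * x0 d'))
       + ((x2 c' * x2 (d s) - 0 * 0) + (x2 (c s) * x2 d' - 0 * 0)))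
      by (unfold lor; ring).
    apply @is_derive_plus.
    + now apply (is_derive_minor (fun r => x1 (c r)) (fun r => x1 (d r))
                   (fun r => x0 (c r)) (fun r => x0 (d r))).
    + now apply (is_derive_minor (fun r => x2 (c r)) (fun r => x2 (d r))
                   (fun _ => 0) (fun _ => 0)).
Qed.

Lemma is_derive_L3_cross (c d : R -> L3) (s : R) (c' d' : L3) :
  is_derive_L3 c s c' -> is_derive_L3 d s d' ->
  is_derive_L3 (fun r => cross (c r) (d r)) s (L3_add (cross c' (d s)) (cross (c s) d')).
Proof.
  intros [C0 [C1 C2]] [D0 [D1 D2]]. split; [|split]; simpl.
  - now apply (is_derive_minor (fun r => x2 (c r)) (fun r => x1 (d r))
                 (fun r => x1 (c r)) (fun r => x2 (d r))).
  - now apply (is_derive_minor (fun r => x2 (c r)) (fun r => x0 (d r))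
                 (fun r => x0 (c r)) (fun r => x2 (d r))).
  - now apply (is_derive_minor (fun r => x0 (c r)) (fun r => x1 (d r))
                 (fun r => x1 (c r)) (fun r => x0 (d r))).
Qed.

Lemma is_derive_L3_scal (g : R -> R) (c : R -> L3) (s g' : R) (c' : L3) :
  is_derive g s g' -> is_derive_L3 c s c' ->
  is_derive_L3 (fun r => L3_scal (g r) (c r)) s
    (L3_add (L3_scal g' (c s)) (L3_scal (g s) c')).
Proof.
  intros G [C0 [C1 C2]].
  split; [|split]; simpl;
    apply (is_derive_mult g); trivial; apply Rmult_comm.
Qed.

Lemma is_derive_L3_ext_loc (c d : R -> L3) (s : R) (w : L3) :
  locally s (fun r => c r = d r) -> is_derive_L3 c s w -> is_derive_L3 d s w.
Proof.
  intros E [C0 [C1 C2]]. split; [|split];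
    (eapply is_derive_ext_loc; [|eassumption]);
    revert E; apply filter_imp; intros r Hr; simpl; now rewrite Hr.
Qed.

Lemma is_derive_locally_const (g : R -> R) (s k l : R) :
  locally s (fun r => g r = k) -> is_derive g s l -> l = 0.
Proof.
  intros E H. rewrite <- (is_derive_unique _ _ _ H).
  rewrite (Derive_ext_loc g (fun _ => k)); trivial. apply Derive_const.
Qed.

Lemma smooth_map_is_derive (D : Defs.domain) (y : R -> R -> L3R) (u v : R) :
  smooth_map D y -> D u v ->
  is_derive_L3 (fun s => fst (y s v)) u (fst (partial_u y u v)) /\
  is_derive_L3 (fun s => fst (y u s)) v (fst (partial_v y u v)) /\
  is_derive (fun s : R => snd (y s v)) u (snd (partial_u y u v)) /\
  is_derive (fun s : R => snd (y u s)) v (snd (partial_v y u v)).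
Proof.
  intros [S0 [S1 [S2 S3]]] Huv.
  destruct (S0 u v Huv 1%nat) as [_ [U0 [V0 _]]].
  destruct (S1 u v Huv 1%nat) as [_ [U1 [V1 _]]].
  destruct (S2 u v Huv 1%nat) as [_ [U2 [V2 _]]].
  destruct (S3 u v Huv 1%nat) as [_ [U3 [V3 _]]].
  repeat match goal with |- _ /\ _ => split | |- is_derive_L3 _ _ _ => split end;
    apply Derive_correct; assumption.
Qed.

Lemma helicoid_rigidity (beta : R) (a b : Rbar) (phi : R -> R) (y M : R -> R -> L3R) :
  helicoid_ode beta a b phi ->
  conformal_immersion (strip a b) y -> direct_unit_normal (strip a b) y M ->
  has_data (strip a b) y M
    (conjugate_data
       (conformal_data (fun u => Derive phi u ^ 2)
         (fun u => beta * cosh (phi u) * (/ Derive phi u) ^ 2)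
         (fun u => beta * sinh (phi u) * / Derive phi u))) ->
  exists F, direct_isometry_H2R F /\
    forall u v, in_interval a b u -> F (y u v) = helicoid beta phi u v.
Proof.
  intros Hode [Sy Hy] [SM HM] Hdata.
  set (p := fun u v => fst (y u v)).
  set (e := fun u v => L3_scal (/ Derive phi u) (fst (partial_u y u v))).
  set (f := fun u v => L3_scal (- Derive phi u) (fst (M u v))).
  assert (DY := fun u v (H : in_interval a b u) =>
                  smooth_map_is_derive (strip a b) y u v Sy H).
  assert (DM := fun u v (H : in_interval a b u) =>
                  smooth_map_is_derive (strip a b) M u v SM H).
  assert (Hframe : forall u v, in_interval a b u ->
    orthonormal_frame (p u v) (e u v) (f u v) /\
    snd (partial_u y u v) = 0 /\ snd (partial_v y u v) = 1 /\
    fst (partial_u y u v) = L3_scal (Derive phi u) (e u v) /\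
    fst (partial_v y u v) = L3_scal (beta * sinh (phi u)) (f u v) /\
    fst (partial_u M u v) =
      L3_scal (beta * cosh (phi u) * (/ Derive phi u) ^ 2 * (beta * sinh (phi u))) (f u v) /\
    fst (partial_v M u v) =
      L3_add (L3_scal (beta * cosh (phi u) * (/ Derive phi u) ^ 2 * Derive phi u) (e u v))
        (L3_scal (- (beta * sinh (phi u) * / Derive phi u)) (p u v))).
  { intros u v Hu.
    destruct (helicoid_pointwise beta a b phi u Hode Hu) as [_ [_ [H3 [H4 H5]]]].
    destruct (Hy u v Hu) as [[Hpp Hp0] [Huv [Huv0 _]]].
    destruct (HM u v Hu) as [Hpm [Hmm [Hmu [Hmv Hvol]]]].
    destruct (Hdata u v Hu) as [Hds [HS [Hnu HT]]].
    destruct (DY u v Hu) as [Yu [Yv _]]. destruct (DM u v Hu) as [Mu [Mv _]].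
    (* Differentiating these constraints gives the tangency of y_u and the relations between
       derivatives of y and M required by [adapted_frame]. *)
    assert (Lp : locally u (fun s => lor (fst (y s v)) (fst (y s v)) = -1)).
    { generalize (in_interval_locally a b u Hu). apply filter_imp.
      intros s Hs. apply (Hy s v Hs). }
    assert (Lm : locally u (fun s => lor (fst (y s v)) (fst (M s v)) = 0)).
    { generalize (in_interval_locally a b u Hu). apply filter_imp.
      intros s Hs. apply (HM s v Hs). }
    assert (Lm' : locally v (fun s => lor (fst (y u s)) (fst (M u s)) = 0)).
    { apply filter_forall. intros s. apply (HM u s Hu). }
    apply (adapted_frame (y u v) (partial_u y u v) (partial_v y u v)
             (M u v) (partial_u M u v) (partial_v M u v)
             (Derive phi u) (/ Derive phi u)
             (beta * cosh (phi u)) (beta * sinh (phi u))); trivial.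
    - rewrite H3. ring.
    - generalize (is_derive_locally_const _ _ _ _ Lp (is_derive_lor _ _ _ _ _ Yu Yu)).
      rewrite (lor_sym (fst (partial_u y u v))). lra.
    - exact (is_derive_locally_const _ _ _ _ Lm (is_derive_lor _ _ _ _ _ Yu Mu)).
    - exact (is_derive_locally_const _ _ _ _ Lm' (is_derive_lor _ _ _ _ _ Yv Mv)).
    - transitivity (inner (Defs.differential y u v (1, 0)) (Defs.differential y u v (1, 0))).
      + unfold Defs.differential, inner, lor; simpl. ring.
      + rewrite <- Hds. simpl. ring.
    - change (beta * sinh (phi u) * / Derive phi u = inner (M u v) dt) in Hnu.
      rewrite Hnu. unfold inner, lor; simpl. ring.
    - rewrite pow_inv. exact HT.
    - exact (HS (1, 0)).
    - exact (HS (0, 1)). }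
  assert (Hpu : forall u v, in_interval a b u ->
            is_derive_L3 (fun s => p s v) u (L3_scal (Derive phi u) (e u v))).
  { intros u v Hu. destruct (Hframe u v Hu) as [_ [_ [_ [E _]]]].
    rewrite <- E. exact (proj1 (DY u v Hu)). }
  assert (Hpv : forall u v, in_interval a b u ->
            is_derive_L3 (fun s => p u s) v (L3_scal (beta * sinh (phi u)) (f u v))).
  { intros u v Hu. destruct (Hframe u v Hu) as [_ [_ [_ [_ [E _]]]]].
    rewrite <- E. exact (proj1 (proj2 (DY u v Hu))). }
  assert (HMf : forall u v, in_interval a b u ->
            fst (M u v) = L3_scal (- / Derive phi u) (f u v)).
  { intros u v Hu.
    destruct (helicoid_pointwise beta a b phi u Hode Hu) as [_ [_ [_ [H4 _]]]].
    unfold f. apply L3_eq; simpl; field; lra. }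
  (* The factor phi' in f is chosen for this: the term from phi'' = beta^2 sinh phi cosh phi cancels
     the one from M_u. *)
  assert (Hfu : forall u v, in_interval a b u ->
            is_derive_L3 (fun s => f s v) u (mkL3 0 0 0)).
  { intros u v Hu.
    destruct (helicoid_pointwise beta a b phi u Hode Hu) as [_ [H2 [_ [H4 _]]]].
    destruct (Hframe u v Hu) as [_ [_ [_ [_ [_ [E _]]]]]].
    destruct (DM u v Hu) as [Mu _].
    assert (H := is_derive_L3_scal (fun s => - Derive phi s) (fun s => fst (M s v))
      u _ _ (is_derive_opp _ _ _ H2) Mu).
    rewrite E, (HMf u v Hu) in H.
    match type of H with is_derive_L3 _ _ ?w => replace (mkL3 0 0 0) with w end;
      [exact H|].
    unfold opp; apply L3_eq; simpl; field; lra. }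
  assert (Hfv : forall u v, in_interval a b u ->
            is_derive_L3 (fun s => f u s) v
              (L3_add (L3_scal (beta * sinh (phi u)) (p u v))
                 (L3_scal (- (beta * cosh (phi u))) (e u v)))).
  { intros u v Hu.
    destruct (helicoid_pointwise beta a b phi u Hode Hu) as [_ [_ [_ [H4 _]]]].
    destruct (Hframe u v Hu) as [_ [_ [_ [_ [_ [_ E]]]]]].
    destruct (DM u v Hu) as [_ [Mv _]].
    assert (Z : is_derive (fun _ : R => - Derive phi u) v 0)
      by apply (is_derive_const (- Derive phi u)).
    assert (H := is_derive_L3_scal (fun _ => - Derive phi u) (fun s => fst (M u s))
      v _ _ Z Mv).
    rewrite E in H.
    match type of H with is_derive_L3 _ _ ?w =>
      replace (L3_add (L3_scal (beta * sinh (phi u)) (p u v))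
                 (L3_scal (- (beta * cosh (phi u))) (e u v))) with w end;
      [exact H|].
    apply L3_eq; simpl; field; lra. }
  (* The Leibniz rule for f x p replaces a second derivative of y. *)
  assert (Heu : forall u v, in_interval a b u ->
            is_derive_L3 (fun s => e s v) u (L3_scal (Derive phi u) (p u v))).
  { intros u v Hu. destruct (Hframe u v Hu) as [Fr _].
    destruct (frame_cross _ _ _ Fr) as [_ [E _]].
    apply (is_derive_L3_ext_loc (fun s => cross (f s v) (p s v))).
    - generalize (in_interval_locally a b u Hu). apply filter_imp.
      intros s Hs. apply (frame_cross (p s v)), Hframe, Hs.
    - assert (H := is_derive_L3_cross _ _ _ _ _ (Hfu u v Hu) (Hpu u v Hu)).
      rewrite <- E at 1.
      match type of H with is_derive_L3 _ _ ?w =>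
        replace (L3_scal (Derive phi u) (cross (f u v) (e u v))) with w end; [exact H|].
      apply L3_eq; simpl; ring. }
  assert (Hev : forall u v, in_interval a b u ->
            is_derive_L3 (fun s => e u s) v (L3_scal (beta * cosh (phi u)) (f u v))).
  { intros u v Hu. destruct (Hframe u v Hu) as [Fr _].
    destruct (frame_cross _ _ _ Fr) as [_ [_ E]].
    apply (is_derive_L3_ext_loc (fun s => cross (f u s) (p u s))).
    - apply filter_forall. intros s. apply (frame_cross (p u s)), Hframe, Hu.
    - assert (H := is_derive_L3_cross _ _ _ _ _ (Hfv u v Hu) (Hpv u v Hu)).
      match type of H with is_derive_L3 _ _ ?w =>
        replace (L3_scal (beta * cosh (phi u)) (f u v)) with w end; [exact H|].
      transitivity (L3_scal (- (beta * cosh (phi u))) (cross (e u v) (p u v))).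
      + apply L3_eq; simpl; ring.
      + rewrite E. apply L3_eq; simpl; ring. }
  assert (H0 : in_interval a b 0) by apply Hode.
  destruct (Hframe 0 0 H0) as [Fr0 _].
  (* At (0, 0) the helicoid's own frame is the standard basis and its height is 0, hence coordinates
     in the frame of y at (0, 0) and this translation. *)
  exists (fun q => (mkL3 (- lor (fst q) (p 0 0)) (lor (fst q) (e 0 0)) (lor (fst q) (f 0 0)),
                    snd q + - snd (y 0 0))).
  split.
  - exists (fun w => mkL3 (- lor w (p 0 0)) (lor w (e 0 0)) (lor w (f 0 0))), (- snd (y 0 0)).
    split; [|reflexivity].
    apply frame_coordinates_isometry; trivial. apply (Hy 0 0 H0).
  - intros u v Hu.
    destruct (Hframe u v Hu) as [[Hpp [Hee [Hff [Hpe [Hpf [Hef _]]]]]] _].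
    destruct (moving_frame_const_L3 beta a b phi p e f u v) as [W0 [W1 W2]]; trivial.
    change (fst (y u v)) with (p u v).
    apply L3R_eq; cbn [fst snd x0 x1 x2 helicoid].
    + rewrite <- W0. transitivity (- (cosh (phi u) * lor (p u v) (p u v)
        - sinh (phi u) * lor (p u v) (e u v))).
      * unfold lor; simpl; ring.
      * rewrite Hpp, Hpe. ring.
    + rewrite <- W1. transitivity
        (cos (beta * v) * (cosh (phi u) * lor (p u v) (e u v)
           - sinh (phi u) * lor (p u v) (p u v))
         - sin (beta * v) * lor (p u v) (f u v)).
      * unfold lor; simpl; ring.
      * rewrite Hpp, Hpe, Hpf. ring.
    + rewrite <- W2. transitivity
        (sin (beta * v) * (cosh (phi u) * lor (p u v) (e u v)
           - sinh (phi u) * lor (p u v) (p u v))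
         + cos (beta * v) * lor (p u v) (f u v)).
      * unfold lor; simpl; ring.
      * rewrite Hpp, Hpe, Hpf. ring.
    + assert (Hz : snd (y u v) - v = snd (y 0 0) - 0).
      { apply (strip_const a b (fun s t => snd (y s t) - t)); trivial; intros s t Hs;
          destruct (Hframe s t Hs) as [_ [Eu [Ev _]]];
          destruct (DY s t Hs) as [_ [_ [Yu Yv]]].
        - rewrite Eu in Yu. replace 0 with (0 - 0) by ring.
          apply @is_derive_minus; [exact Yu|apply (is_derive_const t)].
        - rewrite Ev in Yv. replace 0 with (1 - 1) by ring.
          apply @is_derive_minus; [exact Yv|apply (is_derive_id t)]. }
      lra.
Qed.

(** * Independence of the chosen data, and conclusion *)

Lemma has_data_unique (D : Defs.domain) (x N : R -> R -> L3R) (d d' : data) (u v : R) :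
  conformal_immersion D x -> has_data D x N d -> has_data D x N d' -> D u v ->
  (forall X Y, ds2 d u v X Y = ds2 d' u v X Y) /\
  (forall X, S_op d u v X = S_op d' u v X) /\
  T_field d u v = T_field d' u v /\ nu d u v = nu d' u v.
Proof.
  intros [_ Hx] Hd Hd' Huv.
  destruct (Hx u v Huv) as [_ [Hc [H0 Hp]]].
  destruct (Hd u v Huv) as [H1 [H2 [H3 H4]]].
  destruct (Hd' u v Huv) as [H1' [H2' [H3' H4']]].
  (* The differential is injective: pairing with the two orthogonal partials recovers each
     component, as the conformal factor is positive. *)
  assert (Hinj : forall X Y : tvec,
            Defs.differential x u v X = Defs.differential x u v Y -> X = Y).
  { intros [X1 X2] [Y1 Y2] E. rewrite Hc in Hp.
    assert (Eu := f_equal (fun w => inner w (partial_u x u v)) E).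
    assert (Ev := f_equal (fun w => inner w (partial_v x u v)) E).
    assert (L : forall Z1 Z2 w,
      inner (Defs.differential x u v (Z1, Z2)) w
      = Z1 * inner (partial_u x u v) w + Z2 * inner (partial_v x u v) w)
      by (intros; unfold Defs.differential, inner, lor; simpl; ring).
    assert (H0' : inner (partial_v x u v) (partial_u x u v) = 0)
      by (rewrite <- H0; unfold inner, lor; ring).
    cbv beta in Eu, Ev. rewrite !L, H0', Hc in Eu. rewrite !L, H0 in Ev.
    f_equal; apply (Rmult_eq_reg_r (inner (partial_v x u v) (partial_v x u v))); lra. }
  assert (Hnu : nu d u v = nu d' u v) by congruence.
  repeat split; trivial; intros.
  - now rewrite H1, H1'.
  - apply Hinj. now rewrite H2, H2'.
  - apply Hinj. now rewrite H4, H4', Hnu.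
Qed.

(** Replaces the unknown data inside a [conjugate_immersion] by the explicit data of the
    catenoid. *)
Lemma has_data_conjugate_transfer (D : Defs.domain) (x N y M : R -> R -> L3R) (d d' : data) :
  conformal_immersion D x -> has_data D x N d -> has_data D x N d' ->
  has_data D y M (conjugate_data d) -> has_data D y M (conjugate_data d').
Proof.
  intros Hx Hd Hd' Hy u v Huv.
  destruct (has_data_unique D x N d d' u v Hx Hd Hd' Huv) as [E1 [E2 [E3 E4]]].
  destruct (Hy u v Huv) as [H1 [H2 [H3 H4]]]. simpl in *.
  rewrite <- E3, <- E4. repeat split; trivial; intros.
  - now rewrite <- E1.
  - now rewrite <- E2.
Qed.

Lemma same_surface_refl (a b : Rbar) (x x' : R -> R -> L3R) :
  (forall u v, in_interval a b u -> x u v = x' u v) ->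
  same_surface (strip a b) x (strip a b) x'.
Proof.
  intros E. exists (fun u _ => u), (fun _ v => v), (fun u _ => u), (fun _ v => v).
  split; [apply smooth_u|split; [apply smooth_v|split; [apply smooth_u|split; [apply smooth_v|]]]].
  split; intros u v Huv; repeat split; try apply Huv.
  - rewrite !Derive_id, !Derive_const. lra.
  - now apply E.
Qed.

Theorem proposition4p22 (gamma beta : R)
    (a b : Rbar) (chi : R -> R) (c d : Rbar) (phi : R -> R)
    (hgamma : 0 < gamma < 1 \/ -1 < gamma < 0)
    (hbeta : beta ^ 2 + gamma ^ 2 = 1)
    (hsign : 0 < beta * gamma)
    (hchi : maximal_solution (catenoid_ode gamma) a b chi)
    (hphi : maximal_solution (helicoid_ode beta) c d phi) :
  conjugate_surface
    (strip a b) (catenoid gamma chi) (catenoid_normal gamma chi)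
    (strip c d) (helicoid beta phi).
Proof.
  assert (Hg : gamma <> 0) by lra.
  (* The profile equations involve only beta^2 and gamma^2, so the correspondence is applied to the
     absolute values s beta and s gamma, with s the common sign. *)
  assert (Hs : exists s, s ^ 2 = 1 /\ 0 < s * beta /\ 0 < s * gamma).
  { destruct hgamma; [exists 1|exists (-1)]; repeat split; nra. }
  destruct Hs as [s [Hs1 [Hsb Hsg]]].
  assert (Hprof : a = c /\ b = d /\ conjugate_profiles (s * beta) (s * gamma) a b chi phi).
  { assert (Eb : (s * beta) ^ 2 = beta ^ 2) by (rewrite Rpow_mult_distr, Hs1; ring).
    assert (Eg : (s * gamma) ^ 2 = gamma ^ 2) by (rewrite Rpow_mult_distr, Hs1; ring).
    apply maximal_profiles; trivial.
    - now rewrite Eb, Eg.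
    - unfold catenoid_ode. rewrite Eg. exact hchi.
    - unfold helicoid_ode. rewrite Eb. exact hphi. }
  destruct Hprof as [<- [<- Hprof]].
  destruct hchi as [Hchi _]. destruct hphi as [Hphi _].
  assert (Hcat := conformal_minimal_catenoid gamma a b chi Hg Hchi).
  (* The catenoid's data rewritten in terms of phi. The sign s enters each function squared, because
     it is the same for beta and gamma. *)
  assert (Hdata : has_data (strip a b) (catenoid gamma chi) (catenoid_normal gamma chi)
       (conformal_data (fun u => Derive phi u ^ 2)
         (fun u => beta * cosh (phi u) * (/ Derive phi u) ^ 2)
         (fun u => beta * sinh (phi u) * / Derive phi u))).
  { generalize (catenoid_has_data gamma a b chi Hg Hchi).
    apply has_data_conformal_ext. intros u Hu.
    destruct (Hprof u Hu) as [P1 [P2 P3]]. generalize (cosh_pos (chi u)). intros Hc.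
    assert (Hs0 : s <> 0) by (intros ->; lra).
    assert (Hbc : beta * cosh (phi u) = gamma * sinh (chi u))
      by (apply (Rmult_eq_reg_l s); trivial; lra).
    rewrite P1, P2, Hbc. split; [|split].
    - transitivity (s ^ 2 * (gamma * cosh (chi u)) ^ 2); [rewrite Hs1|]; ring.
    - transitivity (s ^ 2 * (gamma * sinh (chi u) * (/ (s * gamma * cosh (chi u))) ^ 2));
        [|rewrite Hs1; ring]. field. repeat split; lra.
    - transitivity (s ^ 2 * (beta * sinh (phi u) * / (s * gamma * cosh (chi u))));
        [|rewrite Hs1; ring]. field. repeat split; lra. }
  split.
  - exists (helicoid beta phi), (helicoid_normal beta phi).
    split; [exact Hcat|split; [now apply conformal_minimal_helicoid|]].
    eexists. split; [exact Hdata|now apply helicoid_has_data].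
  - intros y M [_ [[Hy [HM _]] [d' [Hd Hd']]]].
    destruct (helicoid_rigidity beta a b phi y M) as [F [HF E]]; trivial.
    { apply (has_data_conjugate_transfer _ (catenoid gamma chi) (catenoid_normal gamma chi)
               _ _ d'); trivial. apply Hcat. }
    exists F. split; [exact HF|]. now apply same_surface_refl.
Qed.
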